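(* Let $\mathbb{K}$ be a field, let $V=V_{\bar 0}\oplus V_{\bar 1}$ be a finite-dimensional vector superspace over $\mathbb{K}$ with a non-degenerate orthosymplectic bilinear form $(-,-)$, let $\delta_V=\mathrm{sdim}\,V$ and $G=\mathrm{OSp}(V)$. There is a unique additive ($\mathbb{K}$-linear) covariant functor $F:\mathcal{B}(\delta_V)\to\mathcal{T}_G(V)$ of pre-additive categories with the following properties: (i) $F$ sends the object $r$ to $V^{\otimes r}$ and a morphism $D:k\to\ell$ to $F(D):V^{\otimes k}\to V^{\otimes\ell}$, where $F(D)$ is defined on the generators of Brauer diagrams by $$F(I)=\mathrm{id}_V,\qquad F(X)=P,\qquad F(U)=\check C,\qquad F(A)=\hat C;$$ (ii) $F$ respects tensor products, so that for any objects $r,r'$ and morphisms $D,D'$ in $\mathcal{B}(\delta_V)$, $$F(r\otimes r')=V^{\otimes r}\otimes V^{\otimes r'}=F(r)\otimes F(r'),\qquad F(D\otimes D')=F(D)\otimes F(D').$$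
   Context: Brauer category. A $(k,\ell)$ Brauer diagram is a partition into pairs (arcs) of a set of $k+\ell$ nodes, $k$ on a lower horizontal line and $\ell$ on an upper one. For $\delta\in\mathbb{K}$, $B_k^\ell(\delta)$ is the free $\mathbb{K}$-module on the $(k,\ell)$ Brauer diagrams. Composition $D_1\circ D_2$ places $D_1$ above $D_2$, identifies the corresponding nodes and replaces each closed loop by a factor $\delta$; $D\otimes D'$ is juxtaposition with $D'$ to the right of $D$. $\mathcal{B}(\delta)$ is the $\mathbb{K}$-linear category with objects $\mathbb{N}=\{0,1,2,\dots\}$, $\mathrm{Hom}(k,\ell)=B_k^\ell(\delta)$, and tensor product $k\otimes\ell=k+\ell$ on objects and juxtaposition on morphisms. The diagrams $I\in B_1^1$ (single vertical arc), $X\in B_2^2$ (crossing), $A\in B_2^0$ (cap, one arc joining the two lower nodes), $U\in B_0^2$ (cup, one arc joining the two upper nodes) generate all Brauer diagrams under composition and tensor product. Supergeometry. $[v]\in\mathbb{Z}_2$ is the degree of a homogeneous $v\in V$; $\mathrm{sdim}\,V=\dim V_{\bar 0}-\dim V_{\bar 1}$. The form is orthosymplectic if $(V_{\bar 0},V_{\bar 1})=(V_{\bar 1},V_{\bar 0})=0$ and $(v,v')=(-1)^\alpha(v',v)$ for $v,v'\in V_{\bar\alpha}$, $\alpha=0,1$. $\mathrm{OSp}(V)$ is the affine group superscheme of elements of $\mathrm{GL}(V)$ preserving the form; it acts diagonally on $V^{\otimes t}$. $\mathcal{T}_G(V)$ is the full subcategory of $G$-modules with objects $V^{\otimes r}$,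 $r=0,1,2,\dots$ ($V^{\otimes 0}=\mathbb{K}$), with the usual tensor product. For a homogeneous basis $\{b_i\}$ of $V$ let $\{\bar b_i\}$ be the basis with $(\bar b_i,b_j)=\delta_{ij}$, and let $c_0=\sum_i b_i\otimes\bar b_i$ (independent of the basis). The maps are $P:V\otimes V\to V\otimes V$, $v\otimes w\mapsto(-1)^{[v][w]}w\otimes v$; $\check C:\mathbb{K}\to V\otimes V$, $1\mapsto c_0$; $\hat C:V\otimes V\to\mathbb{K}$, $v\otimes w\mapsto(v,w)$. *)

(* Defs.v *)
From HB Require Import structures.
From mathcomp Require Import all_boot all_algebra.

Set Implicit Arguments.
Unset Strict Implicit.
Unset Printing Implicit Defensive.

Import GRing.Theory.

(* The lower line is the left summand and the upper line the right one. *)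
Definition node (k l : nat) : finType := ('I_k + 'I_l)%type.

(* D is a partition of T into pairs. *)
Definition pairing (T : finType) (D : {set {set T}}) : bool :=
  partition D [set: T] && [forall e in D, #|e| == 2].

Record diagram (k l : nat) :=
  Diagram { arcs :> {set {set node k l}}; arcsP : pairing arcs }.

HB.instance Definition _ k l := [isSub for @arcs k l].
HB.instance Definition _ k l := [Finite of diagram k l by <:].

Lemma pairingP (T : finType) (D : {set {set T}}) :
  [/\ forall e, e \in D -> #|e| = 2,
      forall x, exists2 e, e \in D & x \in e &
      forall e e' x, e \in D -> e' \in D -> x \in e -> x \in e' -> e = e'] <->
  pairing D.
Proof.
split=> [[D2 Dx Du] | /andP[/and3P[/eqP Dc /trivIsetP Dt D0] /forall_inP D2]].
  apply/andP; split; last by apply/forall_inP=> e /D2 ->.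
  apply/and3P; split.
  - rewrite eqEsubset subsetT; apply/subsetP=> x _; apply/bigcupP.
    by have [e eD xe] := Dx x; exists e.
  - apply/trivIsetP=> e e' eD eD'; apply: contraR => /pred0Pn[x /andP[xe xe']].
    by apply/eqP; apply: Du xe'.
  - by apply/negP=> /D2; rewrite cards0.
split=> [e /D2/eqP // | x | e e' x eD eD' xe xe'].
  have : x \in cover D by rewrite Dc inE.
  by case/bigcupP=> e; exists e.
apply/eqP/idPn=> /(Dt _ _ eD eD')/pred0P/(_ x).
by rewrite /= xe xe'.
Qed.

Lemma pairing_invol (T : finType) (f : T -> T) :
  involutive f -> (forall x, f x != x) -> pairing [set [set x; f x] | x : T].
Proof.
move=> fK fN; apply/pairingP; split.
- by move=> _ /imsetP[x _ ->]; rewrite cards2 eq_sym fN.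
- by move=> x; exists [set x; f x]; [exact: imset_f | rewrite set21].
- move=> _ _ z /imsetP[x _ ->] /imsetP[y _ ->] /set2P zx /set2P zy.
  have E u : z = u \/ z = f u -> [set u; f u] = [set z; f z].
    by case=> -> //; rewrite fK setUC.
  by rewrite (E _ zx) (E _ zy).
Qed.

(* The diagram joining x and f x for every node x. *)
Definition diagram_of_invol k l (f : node k l -> node k l)
    (fK : involutive f) (fN : forall x, f x != x) : diagram k l :=
  Diagram (pairing_invol fK fN).

Definition flip k (x : node k k) : node k k :=
  match x with inl i => inr i | inr i => inl i end.
Lemma flipK k : involutive (@flip k). Proof. by case. Qed.
Lemma flip_neq k (x : node k k) : flip x != x. Proof. by case: x. Qed.
Definition diag_id k : diagram k k := diagram_of_invol (@flipK k) (@flip_neq k).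

Definition diag_I : diagram 1 1 := diag_id 1.

Definition cross (x : node 2 2) : node 2 2 :=
  match x with inl i => inr (rev_ord i) | inr i => inl (rev_ord i) end.
Lemma crossK : involutive cross. Proof. by case=> i /=; rewrite rev_ordK. Qed.
Lemma cross_neq x : cross x != x. Proof. by case: x. Qed.
Definition diag_X : diagram 2 2 := diagram_of_invol crossK cross_neq.

Definition cap (x : node 2 0) : node 2 0 :=
  match x with inl i => inl (rev_ord i) | inr i => inr i end.
Lemma capK : involutive cap. Proof. by case=> i //=; rewrite rev_ordK. Qed.
Lemma cap_neq x : cap x != x. Proof. by case: x => [[[|[]]]|[]]. Qed.
Definition diag_A : diagram 2 0 := diagram_of_invol capK cap_neq.

Definition cup (x : node 0 2) : node 0 2 :=
  match x with inl i => inl i | inr i => inr (rev_ord i) end.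
Lemma cupK : involutive cup. Proof. by case=> i //=; rewrite rev_ordK. Qed.
Lemma cup_neq x : cup x != x. Proof. by case: x => [[]|[[|[]]]]. Qed.
Definition diag_U : diagram 0 2 := diagram_of_invol cupK cup_neq.

Section Juxtaposition.
Variables k l k' l' : nat.

Definition left_node (x : node k l) : node (k + k') (l + l') :=
  match x with inl i => inl (lshift k' i) | inr i => inr (lshift l' i) end.
Definition right_node (x : node k' l') : node (k + k') (l + l') :=
  match x with inl i => inl (rshift k i) | inr i => inr (rshift l i) end.

Lemma left_node_inj : injective left_node.
Proof. by case=> i [] j //= [] /val_inj->. Qed.
Lemma right_node_inj : injective right_node.
Proof. by case=> i [] j //= [] /addnI /val_inj->. Qed.
Lemma left_right_node x y : left_node x != right_node y.
Proof.
by case: x y => i [] j //=; apply/eqP => -[] ij; have := ltn_ord i;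
  rewrite ij ltnNge leq_addr.
Qed.
Lemma node_split z :
  (exists x, z = left_node x) \/ (exists x, z = right_node x).
Proof.
case: z => i; case: (splitP i) => j ij;
  by [ left; (exists (inl j) || exists (inr j)); congr (_ _); apply/val_inj
     | right; (exists (inl j) || exists (inr j)); congr (_ _); apply/val_inj].
Qed.

Definition juxt_arcs (D : diagram k l) (D' : diagram k' l') :
    {set {set node (k + k') (l + l')}} :=
  [set left_node @: (e : {set _}) | e in arcs D]
    :|: [set right_node @: (e : {set _}) | e in arcs D'].

Lemma juxt_arcsP D D' : pairing (juxt_arcs D D').
Proof.
have /pairingP[D2 Dx Du] := arcsP D; have /pairingP[D2' Dx' Du'] := arcsP D'.
apply/pairingP; split.
- by move=> _ /setUP[]/imsetP[e eD ->];
    rewrite card_imset; auto; [exact: left_node_inj | exact: right_node_inj].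
- move=> z; case: (node_split z) => -[x ->].
    have [e eD xe] := Dx x; exists (left_node @: e); last exact: imset_f.
    by rewrite inE imset_f.
  have [e eD xe] := Dx' x; exists (right_node @: e); last exact: imset_f.
  by rewrite inE orbC imset_f.
- move=> _ _ z /setUP[]/imsetP[e eD ->] /setUP[]/imsetP[e' eD' ->].
  + move=> /imsetP[x xe ->] /imsetP[y ye /left_node_inj xy].
    by rewrite -xy in ye; rewrite (Du _ _ x eD eD').
  + move=> /imsetP[x xe ->] /imsetP[y ye /eqP].
    by rewrite (negPf (left_right_node _ _)).
  + move=> /imsetP[x xe ->] /imsetP[y ye /eqP].
    by rewrite eq_sym (negPf (left_right_node _ _)).
  + move=> /imsetP[x xe ->] /imsetP[y ye /right_node_inj xy].
    by rewrite -xy in ye; rewrite (Du' _ _ x eD eD').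
Qed.

Definition juxt D D' : diagram (k + k') (l + l') := Diagram (juxt_arcsP D D').

End Juxtaposition.

(* Two involutions of a finite set, the first without fixed points: an orbit *)
(* of the group they generate contains no or two fixed points of the second.  *)
Section Dihedral.
Variables (T : finType) (f g : T -> T).
Hypotheses (fK : involutive f) (gK : involutive g) (fN : forall x, f x != x).

Let e : rel T := [rel x y | (y == f x) || (y == g x)].
Let h x := g (f x).

Lemma card_dihedral x : g x = x ->
  #|[set y | connect e x y & g y == y]| = 2.
Proof.
move=> gx.
have h_inj : injective h by move=> u v /(inv_inj gK)/(inv_inj fK).
have hgh y : h (g (h y)) = g y by rewrite /h gK fK.
have hgi i : iter i h (g (iter i h x)) = x.
  elim: i => [|i IHi]; first by rewrite /= gx.
  by rewrite iterSr /= hgh.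
have gorb i : fconnect h x (g (iter i h x)).
  by rewrite fconnect_sym // -{2}(hgi i) fconnect_iter.
have sub y : connect e x y -> fconnect h x y.
  case/connectP=> p + ->; elim/last_ind: p => [//|p z IHp].
  rewrite rcons_path last_rcons => /andP[/IHp] {IHp}.
  move: (last x p) => {}y hxy; have {hxy} /iter_findex <- := hxy.
  move: (findex _ _ _) => i /orP[]/eqP ->; last exact: gorb.
  by rewrite -[f _]gK -/(h _) -iterS gorb.
have {}sub y : connect e x y = fconnect h x y.
  apply/idP/idP=> [/sub //|/iter_findex <-].
  elim: (findex h x y) => [|i IHi] //=; apply: connect_trans IHi _.
  by apply: (@connect_trans _ _ (f (iter i h x))); apply: connect1;
    rewrite /e /h /= eqxx ?orbT.
pose N := order h x.
have hN : iter N h x = x by apply: iter_order.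
have N0 : 0 < N by apply: order_gt0.
have iinj i : injective (iter i h) by elim: i => [//|i IHi] u v /= /h_inj/IHi.
have oddN : ~~ odd N.
  apply/negP=> oN; have /eqP[] := fN (iter N./2 h x).
  apply: (inv_inj gK); rewrite -/(h _) -iterS; apply/(inv_inj gK).
  rewrite gK; apply: (iinj N./2.+1); rewrite hgi -iterD addSn addnn.
  by rewrite odd_halfK // prednK.
have N2 : N./2 < N by rewrite -divn2 ltn_Pdiv.
have NE : N = N./2 + N./2 by rewrite addnn even_halfK.
have half_neq : x != iter N./2 h x.
  apply/eqP=> xN; have := findex_iter N2; rewrite -/N -xN findex0 => E.
  by rewrite NE -E in N0.
suff -> : [set y | connect e x y & g y == y] = [set x; iter N./2 h x].
  by rewrite cards2 half_neq.
apply/setP=> y; rewrite !inE sub; apply/andP/orP; last first.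
  case=> /eqP->; rewrite ?gx ?connect0 ?fconnect_iter //; split=> //.
  by apply/eqP/(iinj N./2); rewrite hgi -iterD -NE.
case=> /[dup] /findex_max iN /iter_findex <- /eqP.
move: (findex h x y) iN => i iN gi.
have h2i : iter (i + i) h x = x by have := hgi i; rewrite gi iterD.
have [i0|i0] := posnP i; [by left; rewrite i0 | right].
have [ltN|leN] := ltnP (i + i) N.
  by have := findex_iter ltN; rewrite h2i findex0 => /esym/eqP; rewrite addn_eq0 eqn0Ngt i0.
have: iter (i + i - N) h x = x by rewrite -{2}h2i -{2}(subnK leN) iterD hN.
have lt2 : i + i - N < N by rewrite ltn_subLR // -addSn leq_add // ltnW.
move=> E; have := findex_iter lt2; rewrite E findex0 => /esym/eqP.
rewrite subn_eq0 => le2; suff -> : i = N./2 by [].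
have : (i + i)%N = N by apply/eqP; rewrite eqn_leq le2.
by move=> <-; rewrite addnn doubleK.
Qed.
End Dihedral.

(* D1 is placed above D2. *)
Section Composition.
Variables k l m : nat.

(* Vertices of the glued picture: lower, middle and upper nodes. *)
Definition glued : finType := ('I_k + 'I_l + 'I_m)%type.

Definition below (x : node k l) : glued := inl x.
Definition above (x : node l m) : glued :=
  match x with inl j => inl (inr j) | inr i => inr i end.
Definition outer (x : node k m) : glued :=
  match x with inl i => inl (inl i) | inr j => inr j end.

Variables (D1 : diagram l m) (D2 : diagram k l).

Definition glued_adj : rel glued := fun x y =>
  [exists e in arcs D2, [set x; y] == below @: e]
    || [exists e in arcs D1, [set x; y] == above @: e].

Definition glued_components : {set {set glued}} :=
  equivalence_partition (connect glued_adj) [set: glued].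

(* The arcs of the composite are the traces on the outer nodes of the         *)
(* connected components; components without outer nodes are the closed loops. *)
Definition comp_arcs : {set {set node k m}} :=
  [set outer @^-1: C | C : {set glued} in glued_components] :\ set0.

Definition closed_loops : nat :=
  #|[set C in glued_components | outer @^-1: C == set0]|.

Let partner p q (D : diagram p q) (x : node p q) : node p q :=
  odflt x [pick y | (y != x) && ([set x; y] \in arcs D)].

Let partnerP p q (D : diagram p q) x :
  partner D x != x /\ [set x; partner D x] \in arcs D.
Proof.
have /pairingP[D2' Dx Du] := arcsP D.
rewrite /partner; case: pickP => [y /andP[] //|no].
have [e eD xe] := Dx x; have /eqP/cards2P[u [v [uv Ee]]] := D2' _ eD.
move: xe eD; rewrite Ee => /set2P[]xE eD; subst x.
  by have := no v; rewrite eq_sym uv eD.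
by have := no u; rewrite uv setUC eD.
Qed.

Let partner_uniq p q (D : diagram p q) x y :
  y != x -> [set x; y] \in arcs D -> y = partner D x.
Proof.
move=> yx xyD; have [px pD] := partnerP D x.
have /pairingP[_ _ Du] := arcsP D.
have := Du _ _ x xyD pD (set21 _ _) (set21 _ _).
by move/setP/(_ y); rewrite !inE eqxx orbT (negPf yx) => /esym/eqP.
Qed.

Let partnerK p q (D : diagram p q) : involutive (partner D).
Proof.
move=> x; have [px pD] := partnerP D x; apply/esym/partner_uniq.
  by rewrite eq_sym.
by rewrite setUC.
Qed.

Let partnerE p q (D : diagram p q) u v a :
  u != v -> a = [set u; v] -> a \in arcs D ->
  v = partner D u /\ u = partner D v.
Proof.
move=> uv -> uvD; have vE : v = partner D u.
  by apply: partner_uniq; rewrite // eq_sym.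
by split=> //; rewrite vE partnerK.
Qed.

Let set2_eq (T : finType) (x y u v : T) :
  [set x; y] = [set u; v] -> (x = u /\ y = v) \/ (x = v /\ y = u).
Proof.
move=> E; have := set21 u v; have := set22 u v; rewrite -E => /set2P Hv /set2P Hu.
have := set21 x y; have := set22 x y; rewrite E => /set2P Hy /set2P Hx.
by case: Hx => xE; subst x; case: Hy => yE; subst y; auto;
   case: Hu Hv => ? [] ?; subst; auto.
Qed.

Let W : finType := (node k l + node l m)%type.
Let f (w : W) : W :=
  match w with inl x => inl (partner D2 x) | inr x => inr (partner D1 x) end.
Let g (w : W) : W :=
  match w with
  | inl (inr j) => inr (inl j) | inr (inl j) => inl (inr j) | _ => w end.
Let pr (w : W) : glued :=
  match w with inl x => below x | inr x => above x end.
Let out (x : node k m) : W :=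
  match x with inl i => inl (inl i) | inr j => inr (inr j) end.
Let e : rel W := [rel x y | (y == f x) || (y == g x)].

Let glued_adjP x y : reflect (exists2 w, x = pr w & y = pr (f w)) (glued_adj x y).
Proof.
apply: (iffP orP) => [[]/exists_inP[a aD /eqP xy] | [[w|w] -> ->]].
- have /eqP/cards2P[u [v [uv Ea]]] : #|a| = 2.
    by have /pairingP[->] := arcsP D2.
  have [pu pv] := partnerE uv Ea aD.
  move: xy; rewrite Ea imsetU !imset_set1 => /set2_eq[] [-> ->].
    by exists (inl u) => //=; rewrite -pu.
  by exists (inl v) => //=; rewrite -pv.
- have /eqP/cards2P[u [v [uv Ea]]] : #|a| = 2.
    by have /pairingP[->] := arcsP D1.
  have [pu pv] := partnerE uv Ea aD.
  move: xy; rewrite Ea imsetU !imset_set1 => /set2_eq[] [-> ->].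
    by exists (inr u) => //=; rewrite -pu.
  by exists (inr v) => //=; rewrite -pv.
- left; apply/exists_inP; have [_ aD] := partnerP D2 w.
  by exists [set w; partner D2 w] => //=; rewrite imsetU !imset_set1.
- right; apply/exists_inP; have [_ aD] := partnerP D1 w.
  by exists [set w; partner D1 w] => //=; rewrite imsetU !imset_set1.
Qed.

Let gK : involutive g. Proof. by do 2!case. Qed.
Let fK : involutive f. Proof. by case=> x /=; rewrite partnerK. Qed.
Let fN w : f w != w.
Proof. by case: w => x; [case: (partnerP D2 x) | case: (partnerP D1 x)]. Qed.

Let pr_eq w w' : pr w = pr w' -> w' = w \/ w' = g w.
Proof. by case: w w' => [][]i [][]j //= []; auto => ->; auto. Qed.
Let prg w : pr (g w) = pr w. Proof. by do 2!case: w => w. Qed.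

Let adj_sym : symmetric glued_adj.
Proof. by move=> x y; rewrite /glued_adj setUC. Qed.

Let connect_pr w w' : connect glued_adj (pr w) (pr w') = connect e w w'.
Proof.
have e_g u : connect e u (g u) by apply: connect1; rewrite /e /= eqxx orbT.
have e_pr u u' : pr u = pr u' -> connect e u u'.
  by case/pr_eq=> ->; rewrite ?connect0 ?e_g.
apply/idP/idP=> [/connectP[p] | /connectP[p]].
- elim: p w => [|y p IHp] w /=; first by move=> _ /esym/e_pr.
  case/andP=> /glued_adjP[u wu ->] pp lp.
  apply: connect_trans (e_pr _ _ wu) _.
  apply: connect_trans (IHp _ pp lp).
  by apply: connect1; rewrite /e /= eqxx.
- elim: p w => [|y p IHp] w /=; first by move=> _ ->; rewrite connect0.
  case/andP=> /orP[]/eqP-> pp lp; last by rewrite -(prg w) IHp.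
  apply: connect_trans (IHp _ pp lp); apply: connect1.
  by apply/glued_adjP; exists w.
Qed.

Let out_inj : injective out.
Proof. by case=> i [] j //= [] ->. Qed.
Let pr_out x : pr (out x) = outer x. Proof. by case: x. Qed.
Let g_fix w : g w = w -> exists y, w = out y.
Proof. by case: w => [] [] i //= _; [exists (inl i) | exists (inr i)]. Qed.

Lemma comp_arcsP : pairing comp_arcs.
Proof.
have comp C : C \in glued_components <-> exists x, C = [set y | connect glued_adj x y].
  split=> [/imsetP[x _ ->] | [x ->]].
    by exists x; apply/setP=> y; rewrite !inE.
  by apply/imsetP; exists x => //; apply/setP=> y; rewrite !inE.
have sym := sym_connect_sym adj_sym.
have comp_in C x : C \in glued_components -> x \in C ->
    C = [set y | connect glued_adj x y].
  case/comp=> u ->; rewrite inE => ux; apply/setP=> y; rewrite !inE.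
  exact: same_connect ux y.
apply/pairingP; split.
- move=> E /setD1P[/set0Pn[x xE] /imsetP[C Cc EC]]; rewrite {}EC in xE *.
  rewrite inE in xE; rewrite (comp_in _ _ Cc xE).
  have gout : g (out x) = out x by case: (x).
  rewrite -(card_dihedral fK gK fN gout) -(card_imset _ out_inj).
  apply: eq_card => w; rewrite inE; apply/imsetP/andP.
    case=> y; rewrite !inE -!pr_out connect_pr => xy ->.
    by split; [exact: xy | case: (y)].
  case=> xw /eqP gw; have [y wy] := g_fix gw.
  by exists y => //; rewrite !inE -!pr_out connect_pr -wy.
- move=> x; pose C := [set y | connect glued_adj (outer x) y].
  exists (outer @^-1: C); last by rewrite !inE connect0.
  apply/setD1P; split; last by apply/imset_f/comp; exists (outer x).
  by apply/set0Pn; exists x; rewrite !inE connect0.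
- move=> _ _ x /setD1P[_ /imsetP[C Cc ->]] /setD1P[_ /imsetP[C' Cc' ->]].
  rewrite !inE => xC xC'.
  by rewrite (comp_in _ _ Cc xC) -(comp_in _ _ Cc' xC').
Qed.

Definition diag_comp : diagram k m := Diagram comp_arcsP.

End Composition.

Local Open Scope ring_scope.

Section BrauerCategory.
Variable K : fieldType.

(* The morphisms k -> l: the free K-module on the (k, l) Brauer diagrams. *)
Definition brauer (k l : nat) := {ffun diagram k l -> K^o}.

Definition bvec k l (D : diagram k l) : brauer k l := [ffun E => (E == D)%:R].

Definition brauer_id k : brauer k k := bvec (diag_id k).

Definition brauer_comp (delta : K) k l m
    (a : brauer l m) (b : brauer k l) : brauer k m :=
  \sum_(D1 : diagram l m) \sum_(D2 : diagram k l)
    (a D1 * b D2 * delta ^+ closed_loops D1 D2) *: bvec (diag_comp D1 D2).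

Definition brauer_tensor k l k' l'
    (a : brauer k l) (b : brauer k' l') : brauer (k + k') (l + l') :=
  \sum_(D : diagram k l) \sum_(D' : diagram k' l')
    (a D * b D') *: bvec (juxt D D').

End BrauerCategory.

(* Degrees in Z/2 are booleans, addition being (+) and multiplication &&. *)
Record superspace (K : fieldType) := Superspace {
  ss_space :> vectType K;
  ss_part : bool -> {vspace ss_space};
  ss_sum : (ss_part false + ss_part true)%VS = fullv;
  ss_cap : (ss_part false :&: ss_part true)%VS = 0%VS }.

Definition sdim (K : fieldType) (V : superspace K) : int :=
  (\dim (ss_part V false))%:Z - (\dim (ss_part V true))%:Z.

Definition orthosymplectic (K : fieldType) (V : superspace K)
    (beta : {biscalar V}) : Prop :=
  (forall v w, v \in ss_part V false -> w \in ss_part V true ->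
     beta v w = 0 /\ beta w v = 0) /\
  (forall (a : bool) v w, v \in ss_part V a -> w \in ss_part V a ->
     beta v w = (-1) ^+ a * beta w v).

Definition nondegenerate_form (K : fieldType) (V : superspace K)
    (beta : {biscalar V}) : Prop :=
  forall v, (forall w, beta v w = 0) -> v = 0.

Section TensorPowers.
Variables (K : fieldType) (V : superspace K).

Definition bdim : nat := (\dim (ss_part V false) + \dim (ss_part V true))%N.
Definition hbasis : bdim.-tuple V :=
  [tuple of vbasis (ss_part V false) ++ vbasis (ss_part V true)].
Definition par (i : 'I_bdim) : bool := (\dim (ss_part V false) <= i)%N.

Lemma hbasisP : basis_of fullv hbasis.
Proof.
rewrite -(ss_sum V); apply: cat_basis; try exact: vbasisP.
by apply/directv_addP/ss_cap.
Qed.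

Lemma hbasis_par (i : 'I_bdim) : hbasis`_i \in ss_part V (par i).
Proof.
rewrite nth_cat size_tuple /par; case: ltnP => i0 /=.
  by apply: vbasis_mem; apply: (@mem_nth _ 0 (vbasis _)); rewrite size_tuple.
by apply: vbasis_mem; apply: (@mem_nth _ 0 (vbasis _)); rewrite size_tuple ltn_subLR.
Qed.

(* The r-th tensor power of V is the space of coordinate arrays with respect *)
(* to the tensor products of r vectors of [hbasis].                           *)
Definition midx (r : nat) : finType := {ffun 'I_r -> 'I_bdim}.
Definition tpow (r : nat) : vectType K := {ffun midx r -> K^o}.

Definition tbasis r (I : midx r) : tpow r := [ffun J => (J == I)%:R].

Definition lidx r s (I : midx (r + s)) : midx r := [ffun i => I (lshift s i)].
Definition ridx r s (I : midx (r + s)) : midx s := [ffun i => I (rshift r i)].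

Definition tens r s (t : tpow r) (u : tpow s) : tpow (r + s) :=
  [ffun I => t (lidx I) * u (ridx I)].

Definition tvec (v : V) : tpow 1 := [ffun I : midx 1 => coord hbasis (I ord0) v].

Definition tone : tpow 0 := [ffun => 1].

Lemma tvec_is_linear : linear tvec.
Proof. by move=> c v w; apply/ffunP=> I; rewrite !ffunE linearP. Qed.
HB.instance Definition _ := GRing.isLinear.Build K V (tpow 1) _ _ tvec_is_linear.

Lemma tbasis_tens r s (I : midx (r + s)) :
  tbasis I = tens (tbasis (lidx I)) (tbasis (ridx I)).
Proof.
apply/ffunP=> J; rewrite !ffunE -natrM mulnb; congr (_%:R); congr nat_of_bool.
apply/eqP/andP=> [->|[/eqP/ffunP L /eqP/ffunP R]]; first by rewrite !eqxx.
apply/ffunP=> i; case: (split_ordP i) => j ->.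
  by have := L j; rewrite !ffunE.
by have := R j; rewrite !ffunE.
Qed.

Lemma tbasis1 (I : midx 1) : tbasis I = tvec hbasis`_(I ord0).
Proof.
apply/ffunP=> J; rewrite !ffunE coord_free ?(basis_free hbasisP) // eq_sym.
congr (_%:R); congr nat_of_bool; apply/eqP/eqP=> [->//|E].
by apply/ffunP=> i; rewrite (ord1 i) E.
Qed.

(* The linear map with prescribed values on the basis tensors. *)
Definition textend_fun r s (phi : midx r -> tpow s) (t : tpow r) : tpow s :=
  \sum_(I : midx r) t I *: phi I.

Lemma textend_fun_is_linear r s (phi : midx r -> tpow s) :
  linear (textend_fun phi).
Proof.
move=> c t u; rewrite /textend_fun scaler_sumr -big_split /=.
by apply: eq_bigr => I _; rewrite !ffunE scalerDl scalerA.
Qed.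
HB.instance Definition _ r s (phi : midx r -> tpow s) :=
  GRing.isLinear.Build K (tpow r) (tpow s) _ _ (textend_fun_is_linear phi).

Definition textend r s (phi : midx r -> tpow s) : 'Hom(tpow r, tpow s) :=
  linfun (textend_fun phi).

Lemma textendE r s (phi : midx r -> tpow s) I :
  textend phi (tbasis I) = phi I.
Proof.
rewrite lfunE /= /textend_fun (bigD1 I) //= ffunE eqxx scale1r big1 ?addr0 //.
by move=> J /negPf JI; rewrite ffunE JI scale0r.
Qed.

Definition tens_hom r s r' s' (f : 'Hom(tpow r, tpow s))
    (f' : 'Hom(tpow r', tpow s')) : 'Hom(tpow (r + r'), tpow (s + s')) :=
  textend (fun I => tens (f (tbasis (lidx I))) (f' (tbasis (ridx I)))).

Definition braiding : 'Hom(tpow 2, tpow 2) :=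
  textend (fun I : midx 2 => (-1) ^+ (par (I ord0) && par (I ord_max)) *:
    (tens (tvec hbasis`_(I ord_max)) (tvec hbasis`_(I ord0)) : tpow 2)).

Lemma tbasis2 (I : midx 2) :
  tbasis I = tens (tvec hbasis`_(I ord0)) (tvec hbasis`_(I ord_max)).
Proof.
rewrite (tbasis_tens (r := 1) (s := 1)) !tbasis1 !ffunE.
by congr (tens (tvec _`_(I _)) (tvec _`_(I _))); apply/val_inj.
Qed.

Lemma tens2E (v w : V) :
  (tens (tvec v) (tvec w) : tpow 2) =
  \sum_(I : midx 2) (coord hbasis (I ord0) v * coord hbasis (I ord_max) w)
     *: tbasis I.
Proof.
apply/ffunP=> J; rewrite sum_ffunE (bigD1 J) //= big1 ?addr0 => [|I /negPf IJ].
  rewrite !ffunE eqxx [_ *: _]mulr1.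
  by congr (coord _ (J _) v * coord _ (J _) w); apply/val_inj.
by rewrite !ffunE eq_sym IJ scaler0.
Qed.

Lemma coord_hbasis_par (a : bool) v i :
  v \in ss_part V a -> par i != a -> coord hbasis i v = 0.
Proof.
move=> va ia; rewrite (coord_vbasis va) linear_sum big1 // => j _.
rewrite linearZ /=.
suff [k -> ka] : exists2 k : 'I_bdim,
    (vbasis (ss_part V a))`_j = hbasis`_k & par k = a.
  rewrite coord_free ?(basis_free hbasisP) // (_ : (k == i) = false) ?mulr0 //.
  by apply: contraNF ia => /eqP<-; rewrite ka.
case: a va ia j => va ia j.
  exists (rshift (\dim (ss_part V false)) j); last by rewrite /par /= leq_addr.
  by rewrite nth_cat size_tuple /= ltnNge leq_addr /= addKn.
exists (lshift (\dim (ss_part V true)) j).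
  by rewrite nth_cat size_tuple /= ltn_ord.
by apply/negbTE; rewrite /par /= -ltnNge.
Qed.

Lemma sum_midx2 (U : nmodType) (F : 'I_bdim -> 'I_bdim -> U) :
  \sum_(I : midx 2) F (I ord0) (I ord_max) = \sum_i \sum_j F i j.
Proof.
rewrite pair_big; pose mk (p : 'I_bdim * 'I_bdim) : midx 2 :=
  [ffun i => if i == ord0 then p.1 else p.2].
rewrite (reindex mk) /=; first by apply: eq_bigr => p _; rewrite !ffunE.
exists (fun I : midx 2 => (I ord0, I ord_max)) => [[i j] _|I _].
  by rewrite /= !ffunE.
by apply/ffunP=> -[[|[]] ?] //; rewrite ffunE /=; congr (I _); apply/val_inj.
Qed.

Lemma braidingE (a b : bool) v w : v \in ss_part V a -> w \in ss_part V b ->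
  braiding (tens (tvec v) (tvec w)) = (-1) ^+ (a && b) *: tens (tvec w) (tvec v).
Proof.
move=> va wb; rewrite !tens2E linear_sum scaler_sumr /=.
pose F i j := (-1) ^+ (a && b) *: ((coord hbasis i v * coord hbasis j w) *:
  (tens (tvec hbasis`_j) (tvec hbasis`_i) : tpow 2)).
transitivity (\sum_i \sum_j F i j).
  rewrite -sum_midx2; apply: eq_bigr => I _; rewrite linearZ /= textendE /F.
  rewrite !scalerA; congr (_ *: _); rewrite mulrC.
  have [->|ia] := eqVneq (par (I ord0)) a; last first.
    by rewrite (coord_hbasis_par va ia) mul0r !mulr0.
  have [->//|jb] := eqVneq (par (I ord_max)) b.
  by rewrite (coord_hbasis_par wb jb) !mulr0.
rewrite exchange_big -sum_midx2; apply: eq_bigr => I _; rewrite /F mulrC.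
by congr (_ *: (_ *: _)); apply/esym/tbasis2.
Qed.

Variable beta : {biscalar V}.

Definition contraction : 'Hom(tpow 2, tpow 0) :=
  textend (fun I : midx 2 => beta hbasis`_(I ord0) hbasis`_(I ord_max) *: tone).

Lemma contractionE v w :
  contraction (tens (tvec v) (tvec w)) = beta v w *: tone.
Proof.
pose F i j := (coord hbasis i v * coord hbasis j w) *:
  (beta hbasis`_i hbasis`_j *: tone).
rewrite tens2E linear_sum /=; transitivity (\sum_i \sum_j F i j).
  by rewrite -sum_midx2; apply: eq_bigr => I _; rewrite linearZ /= textendE.
rewrite [v in RHS](coord_basis hbasisP) ?memvf // linear_sumlz scaler_suml.
apply: eq_bigr => i _; rewrite linearZl_LR /= [w in RHS](coord_basis hbasisP) ?memvf //.
rewrite linear_sumr mulr_sumr scaler_suml; apply: eq_bigr => j _.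
by rewrite linearZr_LR /F scalerA mulrA.
Qed.

Definition gram : 'M[K]_bdim := \matrix_(i, j) beta hbasis`_i hbasis`_j.

Definition dual_hbasis (i : 'I_bdim) : V :=
  \sum_(k < bdim) invmx gram i k *: hbasis`_k.

Lemma dual_hbasisP : nondegenerate_form beta ->
  forall i j : 'I_bdim, beta (dual_hbasis i) hbasis`_j = (i == j)%:R.
Proof.
move=> nd i j; have uG : gram \in unitmx.
  rewrite -row_free_unit; apply/inj_row_free => u uG.
  pose x : V := \sum_k u 0 k *: hbasis`_k.
  have bx (k : 'I_bdim) : beta x hbasis`_k = (u *m gram) 0 k.
    rewrite linear_sumlz mxE; apply: eq_bigr => l _.
    by rewrite linearZl_LR mxE.
  have x0 : x = 0.
    apply: nd => w; rewrite (coord_basis hbasisP (memvf w)) linear_sumr big1 //.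
    by move=> k _; rewrite linearZr_LR /= bx uG mxE mulr0.
  apply/rowP=> k; rewrite mxE.
  by have /freeP := basis_free hbasisP; move=> /(_ _ x0).
have /matrixP/(_ i j) := mulVmx uG; rewrite !mxE => <-.
rewrite linear_sumlz; apply: eq_bigr => k _.
by rewrite linearZl_LR mxE.
Qed.

Definition c0 : tpow 2 :=
  \sum_(i < bdim) (tens (tvec hbasis`_i) (tvec (dual_hbasis i)) : tpow 2).

Lemma c0_indep (b b' : bdim.-tuple V) :
  nondegenerate_form beta -> basis_of fullv b ->
  (forall i j : 'I_bdim, beta b'`_i b`_j = (i == j)%:R) ->
  \sum_(i < bdim) (tens (tvec b`_i) (tvec b'`_i) : tpow 2) = c0.
Proof.
move=> nd bB bb'.
have coordE k v : coord hbasis k v = beta (dual_hbasis k) v.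
  rewrite [v in RHS](coord_basis hbasisP (memvf v)) linear_sumr (bigD1 k) //=.
  rewrite linearZr_LR /= dual_hbasisP // eqxx mulr1 big1 ?addr0 // => j jk.
  by rewrite linearZr_LR /= dual_hbasisP // eq_sym (negPf jk) mulr0.
have dualE k : \sum_(i < bdim) beta (dual_hbasis k) b`_i *: b'`_i = dual_hbasis k.
  apply/eqP; rewrite -subr_eq0; apply/eqP/nd => w.
  rewrite linearBl (coord_basis bB (memvf w)) !linear_sumr -sumrB big1 //.
  move=> j _; rewrite !linearZr_LR /= -mulrBr linear_sumlz (bigD1 j) //=.
  rewrite linearZl_LR /= bb' eqxx mulr1 big1 ?addr0 ?subrr ?mulr0 // => i ij.
  by rewrite linearZl_LR /= bb' (negPf ij) mulr0.
apply/ffunP=> J; rewrite !sum_ffunE.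
pose p := (J : midx (1 + 1)) (lshift 1 ord0).
pose q := (J : midx (1 + 1)) (rshift 1 ord0).
transitivity (coord hbasis q (dual_hbasis p)).
  rewrite -dualE linear_sum; apply: eq_bigr => i _.
  by rewrite linearZ /= !ffunE coordE.
rewrite (bigD1 p) //= !ffunE coord_free ?(basis_free hbasisP) //.
rewrite eqxx mul1r big1 ?addr0 // => i ip.
by rewrite !ffunE coord_free ?(basis_free hbasisP) // -/p (negPf ip) mul0r.
Qed.

Definition cocontraction : 'Hom(tpow 0, tpow 2) := textend (fun _ => c0).

Lemma cocontractionE : cocontraction tone = c0.
Proof.
have I : midx 0 by apply: finfun => -[].
rewrite (_ : tone = tbasis I) ?textendE //; apply/ffunP=> J.
by rewrite !ffunE (_ : J = I) ?eqxx //; apply/ffunP=> -[].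
Qed.

End TensorPowers.

(* The square of an odd element is not required to vanish in characteristic 2. *)
Record comm_superalgebra (K : fieldType) := CommSuperalgebra {
  sa_alg :> algType K;
  homog : bool -> sa_alg -> Prop;
  homog_linear : forall d (c : K) a b,
    homog d a -> homog d b -> homog d (c *: a + b);
  homog_sum : forall a, exists a0 a1,
    [/\ homog false a0, homog true a1 & a = a0 + a1];
  homog_cap : forall a, homog false a -> homog true a -> a = 0;
  homog1 : homog false 1;
  homogM : forall d d' a b,
    homog d a -> homog d' b -> homog (d (+) d') (a * b);
  homog_comm : forall (d d' : bool) a b,
    homog d a -> homog d' b -> a * b = (-1) ^+ (d && d') * (b * a) }.

Section OSp.
Variables (K : fieldType) (V : superspace K) (beta : {biscalar V}).
Local Notation b := (hbasis V).

(* An A-point of GL(V), i.e. an even automorphism of the right A-module       *)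
(* V (x) A, is given by its matrix: b_j |-> \sum_i b_i (x) g i j.  The sign in *)
(* the last clause comes from moving g k i past b_l.                          *)
Definition OSp (A : comm_superalgebra K) (g : 'M[A]_(bdim V)) : Prop :=
  [/\ forall i j, homog (par i (+) par j) (g i j),
      exists h : 'M[A]_(bdim V), g *m h = 1%:M /\ h *m g = 1%:M &
      forall i j : 'I_(bdim V),
        \sum_(k < bdim V) \sum_(l < bdim V)
          ((-1) ^+ ((par k (+) par i) && par l) * beta b`_k b`_l)
             *: (g k i * g l j) = (beta b`_i b`_j)%:A].

(* The coefficient of b_I = b_{I 0} (x) ... (x) b_{I (r-1)} in the tensor     *)
(* product over A of the g b_{J s} = \sum_i b_i (x) g i (J s); the sign comes *)
(* from moving g (I s) (J s) past the b_{I t} with t > s.                      *)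
Definition diag_act (A : comm_superalgebra K) (g : 'M[A]_(bdim V)) r
    (I J : midx V r) : A :=
  (-1) ^+ (\sum_(s < r) \sum_(t < r | (s < t)%N)
              ((par (I s) (+) par (J s)) && par (I t)))
    * \prod_(s < r) g (I s) (J s).

Definition tpar r (I : midx V r) : bool := odd (\sum_(s < r) par (I s)).

Definition tpow_deg r (d : bool) (t : tpow V r) : Prop :=
  forall I, t I != 0 -> tpar I = d.

(* Morphisms of OSp(V)-modules V^{(x) r} -> V^{(x) s} are even maps which     *)
(* commute with the action of the A-points for every commutative superalgebra *)
(* A.  The second clause equates the matrices of f o g and g o f, with f      *)
(* extended A-linearly.                                                       *)
Definition OSp_hom r s (f : 'Hom(tpow V r, tpow V s)) : Prop :=
  (forall d t, tpow_deg d t -> tpow_deg d (f t)) /\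
  (forall (A : comm_superalgebra K) (g : 'M[A]_(bdim V)), OSp g ->
     forall (J : midx V r) (L : midx V s),
       \sum_(I : midx V r) f (tbasis I) L *: diag_act g I J =
       \sum_(M : midx V s) f (tbasis J) M *: diag_act g L M).

(* The objects V^{(x) r} of T_G(V) are represented by r; their tensor product *)
(* is the sum of exponents, V^{(x) (r + s)} being V^{(x) r} (x) V^{(x) s}     *)
(* through [tens].                                                             *)
Record TG_hom r s :=
  TGHom { TG_map :> 'Hom(tpow V r, tpow V s); TG_mapP : OSp_hom TG_map }.

Lemma tpow_expand r (t : tpow V r) : t = \sum_(I : midx V r) t I *: tbasis I.
Proof.
apply/ffunP=> J; rewrite sum_ffunE (bigD1 J) //= big1 ?addr0 => [|I /negPf IJ].
  by rewrite !ffunE eqxx [_ *: _]mulr1.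
by rewrite !ffunE eq_sym IJ scaler0.
Qed.

Lemma tpow_deg_tbasis r (I : midx V r) : tpow_deg (tpar I) (tbasis I).
Proof. by move=> J; rewrite ffunE; have [->|] := eqVneq J I; rewrite ?eqxx. Qed.

Lemma TG_idP r : OSp_hom (\1%VF : 'Hom(tpow V r, tpow V r)).
Proof.
split=> [d t|A g _ J L]; first by rewrite lfunE.
rewrite (bigD1 L) // [RHS](bigD1 J) //= !big1 => [|I /negPf IJ|I /negPf IJ].
- by rewrite !lfunE /= !ffunE !eqxx.
- by rewrite !lfunE /= !ffunE IJ scale0r.
- by rewrite !lfunE /= !ffunE eq_sym IJ scale0r.
Qed.
Definition TG_id r : TG_hom r r := TGHom (@TG_idP r).

Lemma hom_coord r s (f : 'Hom(tpow V r, tpow V s)) t L :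
  f t L = \sum_(N : midx V r) t N * f (tbasis N) L.
Proof.
rewrite {1}[t]tpow_expand linear_sum sum_ffunE; apply: eq_bigr => N _.
by rewrite linearZ ffunE.
Qed.

Lemma TG_compP r s t (f' : TG_hom s t) (f : TG_hom r s) :
  OSp_hom (f' \o f)%VF.
Proof.
have [[f0 fg] [f0' fg']] := (TG_mapP f, TG_mapP f').
split=> [d u ud|A g gG J L]; first by rewrite lfunE; apply/f0'/f0.
have E I M : (f' \o f)%VF (tbasis I) M =
    \sum_(N : midx V s) f (tbasis I) N * f' (tbasis N) M.
  by rewrite lfunE /= hom_coord.
under eq_bigr => I _ do rewrite E scaler_suml.
rewrite exchange_big /=.
under eq_bigr => N _ do under eq_bigr => I _ do rewrite mulrC -scalerA.
under eq_bigr => N _ do rewrite -scaler_sumr fg // scaler_sumr.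
rewrite exchange_big /=.
under eq_bigr => N _ do under eq_bigr => I _ do rewrite scalerA mulrC -scalerA.
under eq_bigr => N _ do rewrite -scaler_sumr fg' // scaler_sumr.
rewrite exchange_big; apply: eq_bigr => M _ /=.
rewrite E scaler_suml; apply: eq_bigr => N _.
by rewrite scalerA mulrC.
Qed.
Definition TG_comp r s t (f' : TG_hom s t) (f : TG_hom r s) : TG_hom r t :=
  TGHom (TG_compP f' f).

Lemma tpar_cat r s (I : midx V (r + s)) :
  tpar I = tpar (lidx I) (+) tpar (ridx I).
Proof.
rewrite /tpar big_split_ord oddD; congr (odd _ (+) odd _);
  by apply: eq_bigr => i _; rewrite ffunE.
Qed.

Lemma diag_act_cat (A : comm_superalgebra K) (g : 'M[A]_(bdim V)) r s
    (I J : midx V (r + s)) :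
  diag_act g I J =
  (-1) ^+ ((tpar (lidx I) (+) tpar (lidx J)) && tpar (ridx I)) *
    (diag_act g (lidx I) (lidx J) * diag_act g (ridx I) (ridx J)).
Proof.
have signs : (\sum_(p < r + s) \sum_(q < r + s | p < q)
    ((par (I p) (+) par (J p)) && par (I q)) =
  \sum_(p < r) \sum_(q < r | p < q)
    ((par (lidx I p) (+) par (lidx J p)) && par (lidx I q)) +
  \sum_(p < s) \sum_(q < s | p < q)
    ((par (ridx I p) (+) par (ridx J p)) && par (ridx I q)) +
  \sum_(p < r) \sum_(q < s)
    ((par (lidx I p) (+) par (lidx J p)) && par (ridx I q)))%N.
  rewrite big_split_ord /= addnAC -big_split /=; congr (_ + _)%N.
    apply: eq_bigr => p _; rewrite big_split_ord /=; congr (_ + _)%N.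
      by apply: eq_bigr => q _; rewrite !ffunE.
    by apply: eq_big => q; rewrite ?ffunE // ltn_addr.
  apply: eq_bigr => p _; rewrite big_split_ord /= big_pred0 => [|q].
    by apply: eq_big => q; rewrite ?ffunE // ltn_add2l.
  by rewrite ltnNge ltnW // ltn_addr.
have cross : odd (\sum_(p < r) \sum_(q < s)
    ((par (lidx I p) (+) par (lidx J p)) && par (ridx I q))) =
  (tpar (lidx I) (+) tpar (lidx J)) && tpar (ridx I).
  rewrite /tpar -oddD -big_split -oddM big_distrlr /=.
  rewrite !(big_morph odd oddD (erefl : odd 0 = false)).
  apply: eq_bigr => p _.
  rewrite !(big_morph odd oddD (erefl : odd 0 = false)).
  apply: eq_bigr => q _; rewrite oddM oddD !oddb.
  by case: (par _) => //=; case: (par _).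
rewrite /diag_act signs !exprD -[in X in _ * X * _]signr_odd cross.
rewrite big_split_ord /=.
set a := \sum_(p < r) _; set b' := \sum_(p < s) _; set c := (_ && _).
have -> : \prod_(p < r) g (I (lshift s p)) (J (lshift s p)) =
    \prod_(p < r) g (lidx I p) (lidx J p).
  by apply: eq_bigr => p _; rewrite !ffunE.
have -> : \prod_(p < s) g (I (rshift r p)) (J (rshift r p)) =
    \prod_(p < s) g (ridx I p) (ridx J p).
  by apply: eq_bigr => p _; rewrite !ffunE.
move: (\prod_(p < r) _) (\prod_(p < s) _) => x y.
rewrite -[(-1) ^+ a * x * _]mulrA [x * ((-1) ^+ b' * y)]mulrA (commr_sign x b') !mulrA -!exprD.
by rewrite addnC addnA.
Qed.

Lemma sum_midx_cat r s (U : nmodType) (F : midx V r -> midx V s -> U) :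
  \sum_(I : midx V (r + s)) F (lidx I) (ridx I) = \sum_I1 \sum_I2 F I1 I2.
Proof.
rewrite pair_big; pose mk (p : midx V r * midx V s) : midx V (r + s) :=
  [ffun i => match split i with inl j => p.1 j | inr j => p.2 j end].
have mkl p : lidx (mk p) = p.1.
  by apply/ffunP=> j; rewrite !ffunE (unsplitK (inl j)).
have mkr p : ridx (mk p) = p.2.
  by apply/ffunP=> j; rewrite !ffunE (unsplitK (inr j)).
rewrite (reindex mk) /=; first by apply: eq_bigr => p _; rewrite mkl mkr.
exists (fun I : midx V (r + s) => (lidx I, ridx I)) => [p _|I _].
  by rewrite mkl mkr -surjective_pairing.
apply/ffunP=> i; rewrite ffunE; case: split_ordP => j ->; exact: ffunE.
Qed.

Lemma TG_tensorP r s r' s' (f : TG_hom r s) (f' : TG_hom r' s') :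
  OSp_hom (tens_hom f f').
Proof.
have [[f0 fg] [f0' fg']] := (TG_mapP f, TG_mapP f').
have E I L : tens_hom f f' (tbasis I) L =
    f (tbasis (lidx I)) (lidx L) * f' (tbasis (ridx I)) (ridx L).
  by rewrite textendE ffunE.
split=> [d t td L|A g gG J L].
  rewrite [t]tpow_expand linear_sum sum_ffunE => tL.
  have /exists_inP[I _ {tL}] : [exists I in predT,
      (tens_hom f f' (t I *: tbasis I)) L != 0].
    apply: contraNT tL => /exists_inPn tL; apply/eqP/big1 => I _.
    by apply/eqP; have := tL I isT; rewrite negbK.
  rewrite linearZ /= ffunE E !mulf_eq0 !negb_or => /and3P[tI fI fI'].
  rewrite tpar_cat (f0 _ _ (@tpow_deg_tbasis _ _) _ fI).
  by rewrite (f0' _ _ (@tpow_deg_tbasis _ _) _ fI') -tpar_cat td.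
pose sg : A := (-1) ^+ ((tpar (lidx L) (+) tpar (lidx J)) && tpar (ridx L)).
transitivity (sg * ((\sum_I f (tbasis I) (lidx L) *: diag_act g I (lidx J)) *
                    (\sum_I f' (tbasis I) (ridx L) *: diag_act g I (ridx J)))).
  rewrite big_distrlr mulr_sumr /=.
  under [RHS]eq_bigr => I1 _ do rewrite mulr_sumr.
  rewrite -sum_midx_cat; apply: eq_bigr => I _.
  rewrite E diag_act_cat /sg -scalerAl -!scalerAr !scalerA.
  have [->|fI] := eqVneq (f (tbasis (lidx I)) (lidx L)) 0.
    by rewrite !mul0r !scale0r.
  have [->|fI'] := eqVneq (f' (tbasis (ridx I)) (ridx L)) 0.
    by rewrite !mulr0 !scale0r.
  rewrite (f0 _ _ (@tpow_deg_tbasis _ _) _ fI).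
  by rewrite (f0' _ _ (@tpow_deg_tbasis _ _) _ fI').
rewrite fg // fg' // big_distrlr mulr_sumr /=.
under eq_bigr => I1 _ do rewrite mulr_sumr.
rewrite -sum_midx_cat; apply: eq_bigr => M _.
rewrite E diag_act_cat /sg -scalerAl -!scalerAr !scalerA.
have [->|fI] := eqVneq (f (tbasis (lidx J)) (lidx M)) 0.
  by rewrite !mul0r !scale0r.
by rewrite (f0 _ _ (@tpow_deg_tbasis _ _) _ fI).
Qed.
Definition TG_tensor r s r' s' (f : TG_hom r s) (f' : TG_hom r' s') :
  TG_hom (r + r') (s + s') := TGHom (TG_tensorP f f').

(* K-linear functors B(sdim V) -> T_G(V) with object map k |-> V^{(x) k}. *)
Definition linear_functor (F : forall k l, brauer K k l -> TG_hom k l) : Prop :=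
  [/\ forall k l, linear (fun a : brauer K k l => TG_map (F k l a)),
      forall k, F k k (brauer_id K k) = TG_id k &
      forall k l m (a : brauer K l m) (a' : brauer K k l),
        F k m (brauer_comp (sdim V)%:~R a a') = TG_comp (F l m a) (F k l a')].

End OSp.

(* Main.v *)
(* The matrix coefficients of F(D) are a state sum: colour every node by a      *)
(* vector of the homogeneous basis, and take the product of a weight for every  *)
(* arc (an entry of the Gram matrix for a cap, of its inverse for a cup, a      *)
(* Kronecker delta for a through strand) and of a sign -1 for every crossing of *)
(* two odd arcs.  For a composite, the sum over the colours of the middle nodes *)
(* is carried out one node at a time, innermost first in the circular order of  *)
(* the boundary: it either joins two arcs, because the Gram matrix is           *)
(* contracted with its inverse, or closes a loop, which contributes             *)
(* \sum_i (-1)^[b_i] = sdim V.  All remaining nodes lie outside the contracted  *)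
(* pair, so the crossing signs of two joined arcs multiply to those of their    *)
(* union.  Every diagram is built from I, X, A, U by tensor products and        *)
(* compositions without closed loops; this gives both the OSp(V)-equivariance   *)
(* of F(D) and the uniqueness of F.                                             *)

From HB Require Import structures.
Require Import Defs.
From mathcomp Require Import all_boot all_algebra zify ring.
From Stdlib Require Import ProofIrrelevance FunctionalExtensionality.

Set Implicit Arguments.
Unset Strict Implicit.
Unset Printing Implicit Defensive.

Import GRing.Theory.

(** * Pairings and gluing *)

(** Existence rests on an explicit formula. [amp] is the state sum of a list of arcs, [coef] its
    value for a diagram, and [diag_map] the linear map with these matrix coefficients. [amp_listing]
    shows that neither the order nor the orientation of the listed arcs matters.

    Juxtaposed diagrams have no crossings between them, so state sums multiply ([diag_map_juxt]).
    For a composite, [eliminate] sums over the colours of the middle nodes: [amp_contract] joins two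
    arcs at a node, [amp_loop] removes a closed arc and yields a factor [sdim V]. The same induction
    follows the connected components of the glued picture; hence the exponent of [sdim V] is the
    number of closed loops, and the surviving arcs are those of the composite ([diag_map_comp]).

    The induction principle [diagram_ind] builds every diagram from I, X, A, U and the empty diagram
    by juxtaposition and loop-free composition. It is used twice. In [OSp_hom_diag_map] it reduces
    equivariance to the braiding (supercommutativity), the contraction (invariance of the form) and
    the cocontraction ([OSp_inverse]). In the theorem it forces any functor with the stated
    properties to agree with [diag_map] on diagrams, hence everywhere by linearity. *)

Section Pairings.
Variables (T : finType) (D : {set {set T}}).
Hypothesis DP : pairing D.

Lemma arc_exists x : exists2 y, y != x & [set x; y] \in D.
Proof.
have /pairingP[D2 Dx _] := DP; have [e eD xe] := Dx x.
have /eqP/cards2P[u [v [uv E]]] := D2 _ eD.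
move: xe eD; rewrite E => /set2P[]-> eD; first by exists v; rewrite // eq_sym.
by exists u; rewrite // setUC.
Qed.

Lemma arc_neq x y : [set x; y] \in D -> x != y.
Proof.
have /pairingP[D2 _ _] := DP; move=> /D2; rewrite cards2.
by case: (x != y).
Qed.

Lemma arc_unique x y z : [set x; y] \in D -> [set x; z] \in D -> y = z.
Proof.
move=> xy xz; have /pairingP[_ _ Du] := DP.
have := Du _ _ x xy xz (set21 _ _) (set21 _ _).
move=> /setP/(_ y); rewrite !inE eqxx orbT eq_sym (negPf (arc_neq xy)).
by move=> /esym/eqP.
Qed.

Lemma arc_endpoints e : e \in D -> exists x y, e = [set x; y].
Proof.
have /pairingP[D2 _ _] := DP.
by move=> /D2/eqP/cards2P[x [y [_ ->]]]; exists x, y.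
Qed.

(** Each arc of [D'] shares a point with some arc of [D], which is itself an arc of [D'], and the
    arcs of [D'] are disjoint. Equality of diagrams thus needs only one inclusion. *)
Lemma pairing_subset D' : pairing D' -> D \subset D' -> D = D'.
Proof.
move=> D'P sD; apply/eqP; rewrite eqEsubset sD; apply/subsetP=> e eD'.
have /pairingP[D2' _ Du'] := D'P; have /pairingP[_ Dx _] := DP.
have /card_gt0P[x xe] : 0 < #|e| by rewrite D2'.
have [e' e'D xe'] := Dx x.
by rewrite (Du' e e' x eD' (subsetP sD _ e'D) xe xe').
Qed.

(** The second hypothesis says that no arc leaves the image of [h]. This serves both to cut out a
    part of a diagram and to relabel its nodes. *)
Lemma pairing_preim (T' : finType) (h : T' -> T) : injective h ->
    (forall x y, [set h x; y] \in D -> exists z, y = h z) ->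
  pairing [set e : {set T'} | h @: e \in D].
Proof.
move=> h_inj hD; have /pairingP[D2 Dx Du] := DP; apply/pairingP; split.
- by move=> e; rewrite inE => /D2; rewrite card_imset.
- move=> x; have [y _ xy] := arc_exists (h x); have [z yz] := hD _ _ xy.
  exists [set x; z]; last exact: set21.
  by rewrite inE imsetU !imset_set1 -yz.
- move=> e e' x; rewrite !inE => eD eD' xe xe'; apply: (imset_inj h_inj).
  by apply: (Du _ _ (h x)) => //; apply: imset_f.
Qed.

End Pairings.

Lemma diagram_eqP k l (D D' : diagram k l) :
  (forall x y, [set x; y] \in arcs D -> [set x; y] \in arcs D') -> D = D'.
Proof.
move=> DD'; apply/val_inj/(pairing_subset (arcsP D) (arcsP D')).
apply/subsetP=> e eD; have [x [y E]] := arc_endpoints (arcsP D) eD.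
by move: eD; rewrite E; apply: DD'.
Qed.

Lemma mem_invol k l (f : node k l -> node k l) fK fN x :
  [set x; f x] \in arcs (@diagram_of_invol k l f fK fN).
Proof. exact: imset_f. Qed.

Lemma mem_juxt_left k l k' l' (D : diagram k l) (D' : diagram k' l') x y :
  [set x; y] \in arcs D ->
  [set left_node k' l' x; left_node k' l' y] \in arcs (juxt D D').
Proof.
move=> xyD; rewrite inE; apply/orP; left; apply/imsetP.
by exists [set x; y]; rewrite // imsetU !imset_set1.
Qed.

Lemma mem_juxt_right k l k' l' (D : diagram k l) (D' : diagram k' l') x y :
  [set x; y] \in arcs D' ->
  [set right_node k l x; right_node k l y] \in arcs (juxt D D').
Proof.
move=> xyD; rewrite inE; apply/orP; right; apply/imsetP.
by exists [set x; y]; rewrite // imsetU !imset_set1.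
Qed.

Lemma juxt_id k l : juxt (diag_id k) (diag_id l) = diag_id (k + l).
Proof.
apply/esym/diagram_eqP => x y /imsetP[z _ ->]; case: (node_split z) => -[t ->].
  by have := mem_juxt_left (diag_id l) (mem_invol (@flipK k) (@flip_neq k) t);
    case: t.
by have := mem_juxt_right (diag_id k) (mem_invol (@flipK l) (@flip_neq l) t);
  case: t.
Qed.

Section Gluing.
Variables (k l m : nat) (D1 : diagram l m) (D2 : diagram k l).
Local Notation adj := (glued_adj D1 D2).

Lemma glued_adj_sym : symmetric adj.
Proof. by move=> x y; rewrite /glued_adj setUC. Qed.

Lemma connect_glued_sym : connect_sym adj.
Proof. exact/sym_connect_sym/glued_adj_sym. Qed.

Lemma adj_below x y : [set x; y] \in arcs D2 -> connect adj (below m x) (below m y).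
Proof.
move=> xy; apply/connect1/orP; left; apply/exists_inP; exists [set x; y] => //.
by rewrite imsetU !imset_set1.
Qed.

Lemma adj_above x y : [set x; y] \in arcs D1 -> connect adj (above k x) (above k y).
Proof.
move=> xy; apply/connect1/orP; right; apply/exists_inP; exists [set x; y] => //.
by rewrite imsetU !imset_set1.
Qed.

Lemma glued_componentsE :
  glued_components D1 D2 = [set [set y | connect adj x y] | x : glued k l m].
Proof.
rewrite /glued_components /equivalence_partition.
apply/setP=> C; apply/imsetP/imsetP => -[x _ ->]; exists x => //;
  by apply/setP=> y; rewrite !inE.
Qed.

(** By [comp_arcsP] a nonempty trace of a component on the outer nodes has exactly two elements, so
    two distinct connected outer nodes exhaust it. *)
Lemma mem_diag_comp x y : x != y -> connect adj (outer l x) (outer l y) ->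
  [set x; y] \in arcs (diag_comp D1 D2).
Proof.
move=> xy xyC; have /pairingP[C2 _ _] := comp_arcsP D1 D2.
pose C := @outer k l m @^-1: [set w | connect adj (outer l x) w].
have CP : C \in comp_arcs D1 D2.
  apply/setD1P; split; first by apply/set0Pn; exists x; rewrite !inE connect0.
  by apply: imset_f; rewrite glued_componentsE; apply: imset_f.
rewrite (_ : [set x; y] = C) //; apply/eqP; rewrite eqEcard C2 // cards2 xy andbT.
by apply/subsetP=> z /set2P[]->; rewrite !inE ?connect0.
Qed.

Lemma diag_comp_eq (D : diagram k m) :
  (forall x y, [set x; y] \in arcs D -> connect adj (outer l x) (outer l y)) ->
  diag_comp D1 D2 = D.
Proof.
move=> DC; apply/esym/diagram_eqP => x y xyD.
by apply: mem_diag_comp (DC _ _ xyD); apply: arc_neq (arcsP D) _ _ xyD.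
Qed.

Lemma closed_loops_eq0 :
  (forall j : 'I_l, exists x : node k m,
     connect adj (inl (inr j)) (outer l x)) ->
  closed_loops D1 D2 = 0.
Proof.
move=> mid; apply/eqP; rewrite cards_eq0; apply/eqP/setP=> C; rewrite !inE.
rewrite glued_componentsE; apply/negP=> /andP[/imsetP[z _ ->] /eqP/setP C0].
have [x zx] : exists x, connect adj z (outer l x).
  case: z {C0} => [[i|j]|i]; [by exists (inl i) | exact: mid | by exists (inr i)].
by have := C0 x; rewrite !inE zx.
Qed.

End Gluing.

(** * Generation of the Brauer diagrams *)

Section DiagramInduction.
Variable P : forall k l, diagram k l -> Prop.
Hypothesis P_id0 : P (diag_id 0).
Hypothesis P_I : P diag_I.
Hypothesis P_X : P diag_X.
Hypothesis P_A : P diag_A.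
Hypothesis P_U : P diag_U.
Hypothesis P_comp : forall k l m (D1 : diagram l m) (D2 : diagram k l),
  closed_loops D1 D2 = 0 -> P D1 -> P D2 -> P (diag_comp D1 D2).
Hypothesis P_juxt : forall k l k' l' (D : diagram k l) (D' : diagram k' l'),
  P D -> P D' -> P (juxt D D').

Lemma diagram_ind_id k : P (diag_id k).
Proof.
elim: k => [|k IHk]; first exact: P_id0.
by have := P_juxt P_I IHk; rewrite juxt_id.
Qed.

Section AdjacentTransposition.
Variables (k a b : nat).

Definition adj_swap (u : 'I_(a + (2 + b))) : 'I_(a + (2 + b)) :=
  match split u with
  | inl _ => u
  | inr v => match split v with
             | inl w => rshift a (lshift b (rev_ord w))
             | inr _ => u
             end
  end.

Lemma adj_swap_val u : adj_swap u =
  (if u == a :> nat then a.+1 else if u == a.+1 :> nat then a else u) :> nat.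
Proof.
rewrite /adj_swap; case: splitP => [v uv|v uv].
  by have := ltn_ord v; repeat case: eqP => ?; lia.
case: splitP => w vw; last by repeat case: eqP => ?; lia.
by have := ltn_ord w; rewrite /=; repeat case: eqP => ?; lia.
Qed.

Lemma adj_swapK : involutive adj_swap.
Proof.
move=> u; apply/val_inj; rewrite /= !adj_swap_val.
have aS := gtn_eqF (ltnSn a); have [->|ua] := eqVneq (val u) a;
  first by rewrite ?eqxx ?aS ?eqxx.
have [->|ua1] := eqVneq (val u) a.+1; first by rewrite ?aS ?eqxx.
by rewrite ?(negPf ua) ?(negPf ua1) ?(negPf ua) ?(negPf ua1).
Qed.

Definition swap_diag : diagram (a + (2 + b)) (a + (2 + b)) :=
  juxt (diag_id a) (juxt diag_X (diag_id b)).

Lemma mem_swap_diag u : [set inl (adj_swap u); inr u] \in arcs swap_diag.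
Proof.
rewrite /adj_swap; case: split_ordP => v ->.
  exact: (mem_juxt_left _ (mem_invol (@flipK a) (@flip_neq a) (inl v))).
case: split_ordP => w ->; apply: (mem_juxt_right _ (x := inl _) (y := inr _)).
  apply: (mem_juxt_left _ (x := inl _) (y := inr _)).
  by have := mem_invol crossK cross_neq (inl (rev_ord w)); rewrite /= rev_ordK.
exact: (mem_juxt_right _ (mem_invol (@flipK b) (@flip_neq b) (inl w))).
Qed.

Definition swap_node (x : node k (a + (2 + b))) : node k (a + (2 + b)) :=
  match x with inl i => inl i | inr u => inr (adj_swap u) end.

(** [D'] is the composite of [swap_diag] above [D]. No loop arises, because every strand of
    [swap_diag] leads to an upper node. *)
Lemma diagram_ind_swap (D D' : diagram k (a + (2 + b))) :
  (forall x y, [set x; y] \in arcs D' ->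
     [set swap_node x; swap_node y] \in arcs D) ->
  P D -> P D'.
Proof.
move=> DD' PD; set S := swap_diag.
have out x : connect (glued_adj S D) (outer _ x) (below _ (swap_node x)).
  case: x => [i|u]; first exact: connect0.
  by rewrite connect_glued_sym; exact: (adj_above D (mem_swap_diag u)).
have <- : diag_comp S D = D'.
  apply: diag_comp_eq => x y /DD' /(adj_below S) xy.
  apply: connect_trans (out x) (connect_trans xy _).
  by rewrite connect_glued_sym.
apply: P_comp => //.
  apply: closed_loops_eq0 => j; exists (inr (adj_swap j)).
  by rewrite connect_glued_sym; have := out (inr (adj_swap j));
    rewrite /= adj_swapK.
apply: P_juxt; first exact: diagram_ind_id.
by apply: P_juxt P_X _; apply: diagram_ind_id.
Qed.

End AdjacentTransposition.

(** The other nodes are paired among themselves, so [D] is [diag_U] juxtaposed with some [D']. *)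
Lemma diagram_ind_cup l (D : diagram 0 (2 + l)) :
  [set inr (lshift l ord0); inr (lshift l ord_max)] \in arcs D ->
  (forall D' : diagram 0 l, P D') -> P D.
Proof.
move=> UD PD.
have leftU (w : node 0 2) : exists2 w' : node 0 2,
    [set left_node 0 l w; left_node 0 l w'] \in arcs D &
    [set w; w'] \in arcs diag_U.
  case: w => -[i li] //; exists (inr (rev_ord (Ordinal li)));
    last exact: (mem_invol cupK cup_neq (inr _)).
  rewrite (_ : [set _; _] = [set inr (lshift l ord0); inr (lshift l ord_max)]) //.
  by case: i li => [|[]] // li; last rewrite setUC;
    congr [set inr _; inr _]; apply/val_inj.
have hD x y : [set right_node 0 2 x; y] \in arcs D ->
    exists z, y = right_node 0 2 z.
  case: (node_split y) => -[w -> xw]; last by exists w.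
  have [w' ww' _] := leftU w; rewrite setUC in xw.
  have /esym E := arc_unique (arcsP D) xw ww'.
  by have /eqP[] := left_right_node w' x.
pose D' := Diagram (pairing_preim (arcsP D) (@right_node_inj 0 2 0 l) hD).
have -> : D = juxt diag_U D'.
  apply: diagram_eqP => x y; case: (@node_split 0 2 0 l x) => -[w -> xy].
    have [w' ww' wU] := leftU w; rewrite (arc_unique (arcsP D) xy ww').
    exact: (mem_juxt_left D' wU).
  have [z yz] := hD _ _ xy; rewrite yz in xy *.
  by apply: (mem_juxt_right diag_U (D' := D')); rewrite inE imsetU !imset_set1.
exact: (P_juxt P_U (PD D')).
Qed.

(** The outer induction is on the number of nodes, the inner one on the position of the partner [u]
    of the leftmost node. Adjacent transpositions move [u] to the left until a cup splits off. *)
Lemma diagram_ind_upper l (D : diagram 0 l) : P D.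
Proof.
have [n ln] := ubnP l; elim: n l D ln => // n IHn [|l] D ln.
  by rewrite (_ : D = diag_id 0) //; apply: diagram_eqP => -[] [].
have {}IHn m (D' : diagram 0 m) : m <= l -> P D'.
  by move=> ml; apply: IHn; apply: leq_ltn_trans ml _.
have [y y0] := arc_exists (arcsP D) (inr ord0).
case: y y0 => [[]//|u] u0.
have {u0} : 0 < u.
  by rewrite lt0n; apply: contraNneq u0 => ?; apply/eqP; congr inr; apply/val_inj.
case uj: (nat_of_ord u) => [//|j] _.
(* The leftmost node becomes a variable [z] of value 0, so that [l.+1] can be generalised and later
   written as [a + (2 + b)]. *)
move: (@ord0 l) (erefl : nat_of_ord (@ord0 l) = 0).
have {}IHn m (D' : diagram 0 m) : m.+1 < l.+1 -> P D'.
  by move=> ?; apply: IHn; apply: ltnW.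
move: l.+1 D u uj IHn {ln} => {}l; elim: j => [|j IHj] D u uj IHn z z0 zu.
  have E : l = (2 + (l - 2))%N by have := ltn_ord u; lia.
  move: (l - 2)%N E => l' E; subst l; apply: diagram_ind_cup;
    last by move=> D'; apply: IHn; lia.
  rewrite (_ : [set _; _] = [set inr z; inr u]) //.
  by congr [set inr _; inr _]; apply/val_inj; rewrite /= ?z0 ?uj.
(* Here [u] has position j+2. Exchanging the positions j+1 and j+2 lowers it by one and leaves
   position 0 alone. *)
have E : l = (j.+1 + (2 + (l - j.+3)))%N by have := ltn_ord u; lia.
move: (l - j.+3)%N E => b E; subst l.
have swapK : involutive (@swap_node 0 j.+1 b) by case=> // v; rewrite /= adj_swapK.
have hD x y : [set @swap_node 0 j.+1 b x; y] \in arcs D ->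
    exists z, y = swap_node z.
  by exists (swap_node y); rewrite swapK.
pose D' := Diagram (pairing_preim (arcsP D) (inv_inj swapK) hD).
apply: (@diagram_ind_swap _ _ _ D').
  by move=> x y xy; rewrite inE imsetU !imset_set1 !swapK.
apply: (IHj D' (adj_swap u) _ IHn z z0 _).
  by rewrite adj_swap_val uj; repeat case: eqP => ?; lia.
rewrite inE imsetU !imset_set1 /= adj_swapK (_ : adj_swap z = z) //.
by apply/val_inj; rewrite /= adj_swap_val z0.
Qed.

(* Bending the leftmost lower node upwards is undone by a zigzag. *)
Definition unbend k l (x : node k (1 + l)) : node k.+1 l :=
  match x with
  | inl i => inl (rshift 1 i)
  | inr u => match split u with inl _ => inl ord0 | inr j => inr j end
  end.

Lemma unbend_onto k l (y : node k.+1 l) : exists x, y = @unbend k l x.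
Proof.
case: y => [i|j]; last first.
  by exists (inr (rshift 1 j)); rewrite /unbend (unsplitK (inr j)).
case: (@split_ordP 1 k i) => i' E; last by exists (inl i'); rewrite E.
exists (inr (lshift l ord0)); rewrite /unbend (unsplitK (inl _)) E ord1.
by congr inl; apply/val_inj.
Qed.

Lemma unbend_inj k l : injective (@unbend k l).
Proof.
move=> [i|u] [i'|u'] /=.
- by case=> E; congr inl; apply/val_inj.
- by case: split_ordP => j ->.
- by case: split_ordP => j ->.
case: split_ordP => j ->; case: split_ordP => j' -> //; first by rewrite !ord1.
by case=> ->.
Qed.

(** Induction on the number of lower nodes. If [D'] is [D] with its leftmost lower node bent
    upwards, then [D] is the composite [D1] above [D2]: the strand from the lower node 0 rises
    through [diag_I], passes over the cap and enters [D'] at the bent node. *)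
Lemma diagram_ind k l (D : diagram k l) : P D.
Proof.
elim: k l D => [|k IHk] l D; first exact: diagram_ind_upper.
have hD (x : node k (1 + l)) y :
    [set unbend x; y] \in arcs D -> exists z, y = @unbend k l z.
  by move=> _; apply: unbend_onto.
pose D' := Diagram (pairing_preim (arcsP D) (@unbend_inj k l) hD).
pose D2 : diagram (1 + k) (2 + l) := juxt diag_I D'.
pose D1 : diagram (2 + l) (0 + l) := juxt diag_A (diag_id l).
have I0 : connect (glued_adj D1 D2) (inl (inl ord0)) (inl (inr ord0)).
  have := mem_juxt_left D' (mem_invol (@flipK 1) (@flip_neq 1) (inl ord0)).
  move/(adj_below D1); rewrite /below /=; congr connect; congr (inl (_ _));
    exact/val_inj.
have out x : connect (glued_adj D1 D2) (outer (2 + l) (unbend x))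
    (below l (@right_node 1 1 k (1 + l) x)).
  case: x => [i|u]; first exact: connect0.
  rewrite /unbend; case: split_ordP => j ->.
    rewrite ord1; apply: connect_trans I0 _.
    have := mem_juxt_left (diag_id l) (mem_invol capK cap_neq (inl ord0)).
    move/(adj_above D2); congr connect; congr (inl (inr _)); exact/val_inj.
  have := mem_juxt_right diag_A (mem_invol (@flipK l) (@flip_neq l) (inr j)).
  move/(adj_above D2); congr connect; first by congr inr; apply/val_inj.
  by congr (inl (inr _)); exact/val_inj.
have <- : diag_comp D1 D2 = D.
  apply: diag_comp_eq => x y; have [x' ->] := unbend_onto x.
  have [y' ->] := unbend_onto y => xy.
  apply: connect_trans (out x') _; rewrite connect_glued_sym.
  apply: connect_trans (out y') _; rewrite connect_glued_sym.
  by apply/adj_below/(mem_juxt_right diag_I (D' := D'));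
    rewrite inE imsetU !imset_set1.
apply: (P_comp (D1 := D1) (D2 := D2)).
- apply: closed_loops_eq0 => j; case: (@split_ordP 1 (1 + l) j) => j' ->.
    exists (inl ord0); rewrite connect_glued_sym; move: I0; congr connect.
    by rewrite ord1; congr (inl (inr _)); apply/val_inj.
  exists (unbend (inr j')); rewrite connect_glued_sym.
  exact: (out (inr j')).
- exact: (P_juxt P_A (diagram_ind_id l)).
- exact: (P_juxt P_I (IHk _ D')).
Qed.

End DiagramInduction.

Local Open Scope ring_scope.

(** * The Gram matrix and its inverse *)

Section ArcWeights.
Variables (K : fieldType) (V : superspace K) (beta : {biscalar V}).
Hypothesis beta_osp : orthosymplectic beta.
Hypothesis beta_nd : nondegenerate_form beta.
Local Notation n := (bdim V).
Local Notation B := (gram beta).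

Lemma gramE i j : B i j = beta (hbasis V)`_i (hbasis V)`_j.
Proof. exact: mxE. Qed.

Lemma gram_par i j : B i j != 0 -> par i = par j.
Proof.
rewrite gramE; have [osp0 _] := beta_osp.
have := hbasis_par i; have := hbasis_par j.
case: (par i) (par j) => [] [] // vj vi.
  by have [_ ->] := osp0 _ _ vj vi; rewrite eqxx.
by have [-> _] := osp0 _ _ vi vj; rewrite eqxx.
Qed.

Lemma gram_sym i j : B j i = (-1) ^+ par i * B i j.
Proof.
have [E|ij] := eqVneq (par i) (par j).
  have [_ osp1] := beta_osp; rewrite !gramE; apply: osp1 (hbasis_par i).
  by rewrite E; apply: hbasis_par.
have [->|/gram_par ji] := eqVneq (B j i) 0; last by rewrite ji eqxx in ij.
have [->|/gram_par ji] := eqVneq (B i j) 0; last by rewrite ji eqxx in ij.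
by rewrite mulr0.
Qed.

Lemma gram_unit : B \in unitmx.
Proof.
suff /mulmx1_unit[_ ->] : invmx B *m B = 1%:M by [].
apply/matrixP=> i j; rewrite !mxE -(dual_hbasisP beta_nd) linear_sumlz.
by apply: eq_bigr => k _; rewrite linearZl_LR gramE.
Qed.

(** The Gram matrix commutes with the projection [E] onto the coordinates of the parity of [i],
    hence so does its inverse. *)
Lemma invgram_par i j : invmx B i j != 0 -> par i = par j.
Proof.
pose E := diag_mx (\row_j (par j == par i)%:R) : 'M[K]_n.
have EB : E *m B = B *m E.
  apply/matrixP=> s t; rewrite mul_diag_mx mul_mx_diag !mxE -gramE.
  have [->|/gram_par ->] := eqVneq (B s t) 0; last exact: mulrC.
  by rewrite mulr0 mul0r.
have {}EB : invmx B *m E = E *m invmx B.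
  by rewrite -[LHS](mulmxK gram_unit) -[_ *m E *m B]mulmxA EB mulKmx ?gram_unit.
have := congr1 (fun M : 'M_n => M i j) EB.
rewrite mul_diag_mx mul_mx_diag !mxE eqxx mul1r.
have [-> //|_ <-] := eqVneq (par j) (par i).
by rewrite mulr0 eqxx.
Qed.

(** The transpose of [B] is [S *m B] with [S] the diagonal matrix of parity signs. As [S] is its own
    inverse, inverting gives [invmx B *m S]. *)
Lemma invgram_sym i j : invmx B j i = (-1) ^+ par i * invmx B i j.
Proof.
pose S := diag_mx (\row_j (-1) ^+ par j) : 'M[K]_n.
have SS : S *m S = 1%:M.
  rewrite mulmx_diag -diag_const_mx; congr diag_mx; apply/rowP=> j'.
  by rewrite !mxE -expr2 sqrr_sign.
have BT : B^T = S *m B.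
  by apply/matrixP=> s t; rewrite mul_diag_mx !mxE -!gramE gram_sym.
have iBT : (invmx B)^T = invmx B *m S.
  rewrite trmx_inv -[RHS]mulmx1 -(mulmxV (x := B^T)) ?unitmx_tr ?gram_unit //.
  by rewrite !mulmxA BT !mulmxA -[invmx B *m S *m S]mulmxA SS mulmx1 mulVmx
    ?gram_unit // mul1mx.
have := congr1 (fun M : 'M_n => M i j) iBT.
rewrite mul_mx_diag !mxE mulrC => ->.
have [->|/invgram_par ->//] := eqVneq (invmx B i j) 0.
by rewrite !mulr0.
Qed.

(* The weight of an arc from an upper (true) or lower (false) node coloured i *)
(* to an upper or lower node coloured j.  Upper nodes are read from right to  *)
(* left, which accounts for the transposition in the last case.               *)
Definition wt (s t : bool) (i j : 'I_n) : K :=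
  match s, t with
  | false, false => B i j
  | false, true => (i == j)%:R
  | true, false => (-1) ^+ par i * (i == j)%:R
  | true, true => invmx B j i
  end.

Lemma wt_par s t i j : wt s t i j != 0 -> par i = par j.
Proof.
case: s t => [] [] /=; first by move/invgram_par.
- by have [->|] := eqVneq i j; rewrite ?mulr0 ?eqxx.
- by have [->|] := eqVneq i j; rewrite ?mulr0 ?eqxx.
- exact: gram_par.
Qed.

Lemma wt_sym s t i j : wt t s j i = (-1) ^+ par i * wt s t i j.
Proof.
case: s t => [] [] /=.
- by rewrite [in RHS](invgram_sym i j) signrMK.
- by rewrite signrMK eq_sym.
- by rewrite eq_sym; have [->//|] := eqVneq i j; rewrite !mulr0.
- exact: gram_sym.
Qed.

(** The index [i] colours a middle node, which is an upper node for the diagram below and a lower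
    node for the diagram above. Unless a cup meets a cap, one factor is a Kronecker delta; a cup
    meeting a cap gives the Gram matrix times its inverse, with the sign of a downward strand. *)
Lemma wt_contract s t a b :
  \sum_i wt s true a i * wt false t i b = wt s t a b.
Proof.
have sumL (F : 'I_n -> K) j : \sum_i (j == i)%:R * F i = F j.
  rewrite (bigD1 j) //= eqxx mul1r big1 ?addr0 // => i /negPf.
  by rewrite eq_sym => ->; rewrite mul0r.
case: s t => [] [] /=.
- rewrite (bigD1 b) //= eqxx mulr1 big1 ?addr0 // => i /negPf ->.
  by rewrite mulr0.
- transitivity ((-1) ^+ par b * (B *m invmx B) b a).
    rewrite mxE mulr_sumr; apply: eq_bigr => i _.
    by rewrite gram_sym mulrCA mulrA [RHS]mulrA mulrAC.
  by rewrite mulmxV ?gram_unit // mxE eq_sym; have [->|] := eqVneq a b;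
    rewrite ?mulr0.
- exact: sumL.
- exact: sumL.
Qed.

Lemma sum_sign_par : \sum_(i < n) (-1) ^+ par i = (sdim V)%:~R :> K.
Proof.
rewrite /sdim rmorphB /= /bdim big_split_ord /=; congr (_ + _).
  rewrite (eq_bigr (fun=> 1)) => [|i _]; first by rewrite sumr_const card_ord.
  by rewrite /par leqNgt /= ltn_ord.
rewrite (eq_bigr (fun=> -1)) => [|i _]; last by rewrite /par /= leq_addr.
by rewrite sumr_const card_ord mulNrn.
Qed.

End ArcWeights.

(** * State sums *)

Fixpoint endpoints (T : Type) (A : seq (T * T)) : seq T :=
  if A is a :: A' then a.1 :: a.2 :: endpoints A' else [::].

Definition flip_arc (T : Type) (a : T * T) := (a.2, a.1).

Lemma mem_endpoints (T : eqType) (A : seq (T * T)) a : a \in A ->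
  a.1 \in endpoints A /\ a.2 \in endpoints A.
Proof.
elim: A => //= b A IHA; rewrite !inE => /predU1P[->|/IHA[-> ->]].
  by rewrite !eqxx !orbT.
by rewrite !orbT.
Qed.

Lemma endpointsP (T : eqType) (A : seq (T * T)) x : x \in endpoints A ->
  exists2 a, a \in A & (x == a.1) || (x == a.2).
Proof.
elim: A => //= b A IHA; rewrite !inE orbA => /orP[xb|/IHA[a aA xa]].
  by exists b; rewrite ?inE ?eqxx.
by exists a; rewrite // inE aA orbT.
Qed.

Lemma endpoints_cat T (A A' : seq (T * T)) :
  endpoints (A ++ A') = endpoints A ++ endpoints A'.
Proof. by elim: A => //= a A ->. Qed.

Lemma endpoints_map T T' (h : T -> T') (A : seq (T * T)) :
  endpoints [seq (h a.1, h a.2) | a <- A] = map h (endpoints A).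
Proof. by elim: A => //= a A ->. Qed.

Lemma perm_endpoints (T : eqType) (A A' : seq (T * T)) :
  perm_eq A A' -> perm_eq (endpoints A) (endpoints A').
Proof.
have E B : endpoints B = flatten [seq [:: a.1; a.2] | a : T * T <- B].
  by elim: B => //= b B ->.
by move=> AA'; rewrite !E; apply/perm_flatten/perm_map.
Qed.

Lemma size_endpoints T (A : seq (T * T)) : size (endpoints A) = (size A).*2.
Proof. by elim: A => //= a A ->. Qed.

Section Amplitude.
Variables (K : fieldType) (V : superspace K) (beta : {biscalar V}).
Hypothesis beta_osp : orthosymplectic beta.
Hypothesis beta_nd : nondegenerate_form beta.
Local Notation n := (bdim V).

Section Points.
Variables (T : eqType) (rk : T -> nat) (up : T -> bool).
Hypothesis rk_inj : injective rk.
Implicit Types (a b : T * T) (A : seq (T * T)) (c : T -> 'I_n).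

(** An arc listed against the rank order receives the sign by which [wt_sym] changes its weight, so
    that the orientation becomes irrelevant. *)
Definition arc_amp c a : K :=
  (-1) ^+ (par (c a.1) && (rk a.2 < rk a.1)%N)
    * wt beta (up a.1) (up a.2) (c a.1) (c a.2).

(** A sum modulo 2: exactly one end of [b] lies between the ends of [a], that is, the two chords
    interleave. *)
Definition crosses a b : bool :=
  (rk b.1 < rk a.1)%N (+) (rk b.1 < rk a.2)%N (+)
  ((rk b.2 < rk a.1)%N (+) (rk b.2 < rk a.2)%N).

Definition odd_arc c a := par (c a.1) && par (c a.2).

Definition crossing c a b := (odd_arc c a && odd_arc c b) && crosses a b.

Fixpoint amp A c : K :=
  if A is a :: A' then
    arc_amp c a * (\prod_(b <- A') (-1) ^+ crossing c a b) * amp A' c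
  else 1.

Lemma rk_swap x y : x != y -> (rk x < rk y)%N = ~~ (rk y < rk x)%N.
Proof.
move=> xy; have : rk x != rk y by rewrite (inj_eq rk_inj).
by case: ltngtP.
Qed.

(** Exchanging the arcs negates all four comparisons, and four negations cancel modulo 2. *)
Lemma crosses_sym a b : uniq (endpoints [:: a; b]) -> crosses a b = crosses b a.
Proof.
case: a b => [s t] [u v] /=; rewrite !inE !negb_or =>
  /and4P[/and3P[_ su sv] /andP[tu tv] _ _].
rewrite /crosses /= (rk_swap su) (rk_swap sv) (rk_swap tu) (rk_swap tv).
by do 4!case: (_ < _)%N.
Qed.

Lemma amp_ext A c c' : {in endpoints A, c =1 c'} -> amp A c = amp A c'.
Proof.
elim: A => //= a A IHA cc'.
have cA : {in endpoints A, c =1 c'}.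
  by move=> x xA; apply: cc'; rewrite !inE xA !orbT.
have a1 : c a.1 = c' a.1 by apply: cc'; rewrite inE eqxx.
have a2 : c a.2 = c' a.2 by apply: cc'; rewrite !inE eqxx orbT.
rewrite IHA // /arc_amp a1 a2; congr (_ * _ * _); apply: eq_big_seq => b bA.
have [b1 b2] := mem_endpoints bA.
by rewrite /crossing /odd_arc a1 a2 !cA.
Qed.

Lemma amp_flip a A c : a.1 != a.2 -> amp (flip_arc a :: A) c = amp (a :: A) c.
Proof.
move=> a12 /=; congr (_ * _ * _).
  rewrite /arc_amp /= (wt_sym beta_osp beta_nd _ _ (c a.1)) (rk_swap a12).
  have [->|/(wt_par beta_osp beta_nd) <-] :=
    eqVneq (wt beta (up a.1) (up a.2) (c a.1) (c a.2)) 0.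
    by rewrite !mulr0.
  by rewrite mulrA -signr_addb; congr ((-1) ^+ _ * _);
    case: (par _) (_ < _)%N => [] [].
have oE : odd_arc c (flip_arc a) = odd_arc c a by apply: andbC.
apply: eq_bigr => b _; rewrite /crossing oE; congr ((-1) ^+ (_ && _)).
by congr (_ (+) _); apply: addbC.
Qed.

Lemma amp_move A1 a A2 c : uniq (endpoints (A1 ++ a :: A2)) ->
  amp (A1 ++ a :: A2) c = amp (a :: A1 ++ A2) c.
Proof.
elim: A1 => //= b A1 IHA /andP[b1 /andP[b2 uA]]; rewrite IHA //=.
rewrite !big_cat !big_cons !big_cat /=.
have -> : crossing c b a = crossing c a b.
  rewrite /crossing andbC [odd_arc c b && _]andbC andbC crosses_sym //.
  move: b1 b2 uA; rewrite endpoints_cat /= !inE !mem_cat !inE !negb_or cat_uniq /=.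
  move=> /and5P[b12 _ b1a b1a' _] /and4P[_ b2a b2a' _] /and3P[_ _ /and3P[+ _ _]].
  by rewrite !inE negb_or b12 b1a b1a' b2a b2a' => /andP[-> _].
ring.
Qed.

Lemma amp_perm A A' c :
  uniq (endpoints A) -> perm_eq A A' -> amp A c = amp A' c.
Proof.
elim: A A' => [|a A IHA] A'; first by rewrite perm_sym => _ /perm_nilP ->.
move=> uA pA; have := perm_uniq (perm_endpoints pA); rewrite uA => /esym uA'.
have aA' : a \in A' by rewrite -(perm_mem pA) mem_head.
case/splitPr: aA' pA uA' => A1 A2 pA uA'; rewrite amp_move //.
have {}pA : perm_eq A (A1 ++ A2).
  by rewrite -(perm_cons a) (perm_trans pA) // -cat1s perm_catCA.
by case/and3P: uA => _ _ uA; rewrite /= -(perm_big _ pA) (IHA _ uA pA).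
Qed.

Lemma odd_arc_flip c a : odd_arc c (flip_arc a) = odd_arc c a.
Proof. exact: andbC. Qed.

Lemma crosses_flip a b : crosses a (flip_arc b) = crosses a b.
Proof. exact: addbC. Qed.

Lemma amp_map_flip (f : T * T -> T * T) A c : uniq (endpoints A) ->
  {in A, forall a, f a = a \/ f a = flip_arc a} ->
  amp (map f A) c = amp A c.
Proof.
elim: A => //= a A IHA /and3P[a1 _ uA] fA.
have {}IHA : amp (map f A) c = amp A c.
  by apply: IHA => // b bA; apply: fA; rewrite inE bA orbT.
have a12 : a.1 != a.2 by apply: contraNneq a1 => ->; apply: mem_head.
rewrite -[RHS]/(amp (a :: A) c).
have -> : amp (a :: A) c = amp (f a :: A) c.
  by case: (fA a (mem_head _ _)) => ->; rewrite ?amp_flip.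
rewrite /= IHA big_map; congr (_ * _ * _); apply: eq_big_seq => b bA.
have [->//|->] : f b = b \/ f b = flip_arc b by apply: fA; rewrite inE bA orbT.
by rewrite /crossing odd_arc_flip crosses_flip.
Qed.

Lemma endpoints_map_flip (f : T * T -> T * T) A :
  {in A, forall a, f a = a \/ f a = flip_arc a} ->
  perm_eq (endpoints (map f A)) (endpoints A).
Proof.
elim: A => //= a A IHA fA.
have {}IHA : perm_eq (endpoints (map f A)) (endpoints A).
  by apply: IHA => b bA; apply: fA; rewrite inE bA orbT.
case: (fA a (mem_head _ _)) => ->; first by rewrite !perm_cons.
apply: perm_trans (permEl (perm_catCA [:: a.2] [:: a.1] _)) _.
by rewrite !perm_cons.
Qed.

Lemma uniq_arcs A : uniq (endpoints A) -> uniq A.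
Proof.
elim: A => //= a A IHA /and3P[a1 _ /IHA ->]; rewrite andbT.
by apply: contra a1 => /mem_endpoints[a1 _]; rewrite inE a1 orbT.
Qed.

(** Reorienting arcs is covered by [amp_map_flip] and reordering them by [amp_perm]. The equality of
    sizes turns the inclusion of the reoriented list into a permutation. *)
Lemma amp_listing A A' c :
  uniq (endpoints A) -> uniq (endpoints A') -> size A = size A' ->
  {in A, forall a, (a \in A') || (flip_arc a \in A')} -> amp A c = amp A' c.
Proof.
move=> uA uA' sA AA'; pose f a := if a \in A' then a else flip_arc a.
have ff : {in A, forall a, f a = a \/ f a = flip_arc a}.
  by move=> a _; rewrite /f; case: ifP; auto.
have ufA : uniq (endpoints (map f A)).
  by rewrite (perm_uniq (endpoints_map_flip ff)).
rewrite -(amp_map_flip _ uA ff); apply: amp_perm => //.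
have sub : {subset map f A <= A'}.
  move=> _ /mapP[a aA ->]; rewrite /f; case: ifP => // aA'.
  by have := AA' a aA; rewrite aA'.
have [|_ E] := uniq_min_size (uniq_arcs ufA) sub; first by rewrite size_map sA.
by apply: uniq_perm => //; apply: uniq_arcs.
Qed.

Lemma amp_cat A A' c :
  {in A & A', forall a b, crosses a b = false} ->
  amp (A ++ A') c = amp A c * amp A' c.
Proof.
elim: A => [|a A IHA] AA' /=; first by rewrite mul1r.
rewrite IHA => [|b b' bA bA']; last by apply: AA'; rewrite // inE bA orbT.
have A'1 : \prod_(b <- A') (-1) ^+ crossing c a b = 1 :> K.
  by rewrite big_seq big1 // => b bA'; rewrite /crossing AA' ?mem_head // andbF.
by rewrite big_cat /= A'1 mulr1 mulrA.
Qed.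

Section Contraction.
Variables (x y : T) (c : T -> 'I_n) (ci : 'I_n -> T -> 'I_n).
Hypotheses (upx : up x) (upy : up y = false) (xy : (rk x < rk y)%N).
Hypotheses (cix : forall i, ci i x = i) (ciy : forall i, ci i y = i).

(** No other endpoint lies between [x] and [y], so comparisons with [x] and with [y] cancel modulo
    2: the crossings of (a, x) and (y, b) with a third arc add up to those of (a, b). The weights
    are joined by [wt_contract]. *)
Lemma amp_contract (a b : T) A : uniq [:: a, x, y, b & endpoints A] ->
  {in [:: a, b & endpoints A], forall z, (rk z < rk x)%N = (rk z < rk y)%N} ->
  {in [:: a, b & endpoints A], forall z i, ci i z = c z} ->
  \sum_i amp [:: (a, x), (y, b) & A] (ci i) = amp ((a, b) :: A) c.
Proof.
move=> uA lxy cic; rewrite /= /arc_amp /=.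
rewrite -(wt_contract beta_osp beta_nd) mulr_sumr !mulr_suml.
apply: eq_bigr => i _.
have aE := cic a (mem_head _ _) i.
have bE : ci i b = c b by apply: cic; rewrite !inE eqxx orbT.
rewrite cix ciy aE bE upx upy -(@amp_ext A (ci i) c) => [|z zA]; last first.
  by rewrite cic // !inE zA !orbT.
(* Where a weight vanishes both sides are zero. Otherwise [a], [i] and [b] have one common parity,
   which becomes the [p] of all signs below. *)
have [-> | /(wt_par beta_osp beta_nd) ai] := eqVneq (wt beta (up a) true (c a) i) 0.
  by rewrite !(mul0r, mulr0).
have [-> | /(wt_par beta_osp beta_nd) ib] :=
  eqVneq (wt beta false (up b) i (c b)) 0.
  by rewrite !(mul0r, mulr0).
rewrite big_cons /crossing /odd_arc /= aE bE cix ciy !ai !ib !andbb.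
set p := par (c b); set P1 := \prod_(e <- A) _; set P2 := \prod_(e <- A) _.
set P3 := \prod_(e <- A) _.
have PE : P1 * P2 = P3.
  rewrite -big_split; apply: eq_big_seq => e /mem_endpoints[e1 e2] /=.
  have cA z : z \in endpoints A -> ci i z = c z.
    by move=> zA; apply: cic; rewrite !inE zA !orbT.
  have lA z : z \in endpoints A -> (rk z < rk x)%N = (rk z < rk y)%N.
    by move=> zA; apply: lxy; rewrite !inE zA !orbT.
  rewrite !cA // -signr_addb -andb_addr; congr ((-1) ^+ (_ && _)).
  rewrite /crosses /= !lA //.
  by move: (rk e.1 < rk y)%N (rk e.2 < rk y)%N (rk e.1 < rk a)%N (rk e.2 < rk a)%N
    (rk e.1 < rk b)%N (rk e.2 < rk b)%N => [] [] [] [] [] [].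
(* The orientation signs of the two arcs and the sign of their mutual crossing combine to the
   orientation sign of the joined arc. *)
have SE : (-1) ^+ (p && (rk x < rk a)%N) * (-1) ^+ (p && crosses (a, x) (y, b)) *
    (-1) ^+ (p && (rk b < rk y)%N) = (-1) ^+ (p && (rk b < rk a)%N) :> K.
  rewrite -!signr_addb -!andb_addr; congr ((-1) ^+ (_ && _)); rewrite /crosses /=.
  have [ax ay] : a != x /\ a != y.
    by move: uA; rewrite /= !inE !negb_or => /andP[/and4P[]].
  have bl : (rk b < rk x)%N = (rk b < rk y)%N by apply: lxy; rewrite !inE eqxx orbT.
  have al : (rk a < rk x)%N = (rk a < rk y)%N by apply/lxy/mem_head.
  rewrite [X in X (+) _ (+) _]rk_swap 1?eq_sym // [(rk y < rk a)%N]rk_swap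
    1?eq_sym //.
  rewrite al bl [(rk y < rk x)%N]ltnNge (ltnW xy) /=.
  by move: (rk a < rk y)%N (rk b < rk y)%N (rk b < rk a)%N => [] [] [].
by rewrite -PE -SE; ring.
Qed.

(** The arc (x, y) interleaves with no other, and its weight is the parity sign of its colour, which
    sums to the superdimension. *)
Lemma amp_loop A :
  {in endpoints A, forall z, (rk z < rk x)%N = (rk z < rk y)%N} ->
  {in endpoints A, forall z i, ci i z = c z} ->
  \sum_i amp ((x, y) :: A) (ci i) = (sdim V)%:~R * amp A c.
Proof.
move=> lxy cic; rewrite -sum_sign_par mulr_suml /=; apply: eq_bigr => i _.
rewrite (@amp_ext A (ci i) c) => [|z zA]; last exact: cic.
rewrite big_seq big1 => [|e /mem_endpoints[e1 e2]].
  rewrite /arc_amp /= cix ciy upx upy /= eqxx [(rk y < rk x)%N]ltnNge (ltnW xy).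
  by rewrite andbF !mulr1 mul1r.
by rewrite /crossing /crosses /= !lxy // !addbb andbF.
Qed.

End Contraction.

End Points.

Lemma amp_map (T T' : eqType) (rk : T -> nat) (rk' : T' -> nat)
    (up : T -> bool) (up' : T' -> bool) (h : T -> T') A c c' :
  (forall x y, (rk' (h x) < rk' (h y))%N = (rk x < rk y)%N) ->
  (forall x, up' (h x) = up x) -> (forall x, c' (h x) = c x) ->
  amp rk' up' [seq (h a.1, h a.2) | a <- A] c' = amp rk up A c.
Proof.
move=> hrk hup hc; elim: A => //= a A ->; rewrite big_map; congr (_ * _ * _).
  by rewrite /arc_amp /= hrk !hup !hc.
by apply: eq_bigr => b _; rewrite /crossing /odd_arc /crosses /= !hrk !hc.
Qed.

End Amplitude.

(** * Components of multigraphs *)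

(** Both images are in bijection with the classes of the common kernel. This compares the components
    of two graphs, which are different sets of vertices. *)
Lemma card_imset_kernel (T U U' : finType) (S : {set T})
    (f : T -> U) (g : T -> U') :
  {in S &, forall x y, (f x == f y) = (g x == g y)} -> #|f @: S| = #|g @: S|.
Proof.
move=> fg; pose P u := [set g x | x in S & f x == u].
have PE x : x \in S -> P (f x) = [set g x].
  move=> xS; apply/setP=> u; rewrite inE; apply/imsetP/eqP => [[y]|->].
    by rewrite inE => /andP[yS]; rewrite fg // => /eqP->.
  by exists x; rewrite // inE xS eqxx.
have P_inj : {in f @: S &, injective P}.
  move=> _ _ /imsetP[x xS ->] /imsetP[y yS ->]; rewrite !PE // => /set1_inj gxy.
  by apply/eqP; rewrite fg // gxy.
rewrite -(card_in_imset P_inj) -[RHS](card_imset _ set1_inj).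
suff -> : P @: (f @: S) = set1 @: (g @: S) by [].
by rewrite -!imset_comp; apply: eq_in_imset => x xS; rewrite /= PE.
Qed.

Section Multigraph.
Variable Y : finType.
Implicit Types (E : seq (Y * Y)) (S O : {set Y}).

Definition edge E : rel Y := fun u v => ((u, v) \in E) || ((v, u) \in E).

Lemma edge_connect_sym E : connect_sym (edge E).
Proof. by apply/sym_connect_sym => u v; rewrite /edge orbC. Qed.

(** With [O] the outer nodes this counts closed loops. The set [S] shrinks during elimination, so
    that an eliminated vertex, still present in [Y], is not counted as an isolated component. *)
Definition components_avoiding O (e : rel Y) S : nat :=
  #|[set [set y | connect e x y] | x in S & [forall o in O, ~~ connect e x o]]|.

Lemma eq_components_avoiding O e e' S : connect e =2 connect e' ->
  components_avoiding O e S = components_avoiding O e' S.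
Proof.
move=> ee'; rewrite /components_avoiding.
have -> : [set x in S | [forall o in O, ~~ connect e x o]] =
          [set x in S | [forall o in O, ~~ connect e' x o]].
  apply/setP=> x; rewrite !inE; congr (_ && _).
  by apply: eq_forallb => o; rewrite ee'.
set S' := [set x in S | _].
suff -> : [set [set y | connect e x y] | x in S'] =
          [set [set y | connect e' x y] | x in S'] by [].
by apply: eq_imset => x; apply/setP=> y; rewrite !inE ee'.
Qed.

Lemma same_component E x y :
  ([set z | connect (edge E) x z] == [set z | connect (edge E) y z]) =
  connect (edge E) x y.
Proof.
apply/eqP/idP => [/setP/(_ y)|xy]; first by rewrite !inE connect0.
by apply/setP=> z; rewrite !inE (same_connect (@edge_connect_sym E) xy).
Qed.

Lemma components_avoiding_sub O e S :
  S \subset O -> components_avoiding O e S = 0%N.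
Proof.
move=> SO; apply/eqP; rewrite cards_eq0; apply/eqP/setP=> C; rewrite inE.
apply/negP=> /imsetP[x]; rewrite inE => /andP[xS /forall_inP/(_ x)].
by rewrite connect0 (subsetP SO) // => /(_ isT).
Qed.

Section ContractVertex.
Variables (u v w : Y) (E : seq (Y * Y)).
Hypotheses (uv : u != v) (wv : w != v) (vE : v \notin endpoints E).
Let E1 := [:: (u, v), (v, w) & E].
Let E2 := (u, w) :: E.
Let r x := if x == v then u else x.

(** The retraction [r] moves [v] to its neighbour [u]. It carries edges of [E1] to connected pairs
    of [E2], and edges of [E2] are paths in [E1]. *)
Lemma connect_contract x y :
  connect (edge E1) x y = connect (edge E2) (r x) (r y).
Proof.
have rE a : a \in E -> r a.1 = a.1 /\ r a.2 = a.2.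
  by move=> /mem_endpoints[a1 a2]; split; rewrite /r;
    case: eqP => // av; have := vE; rewrite -av ?a1 ?a2.
have c2 a : a \in E2 -> connect (edge E2) a.1 a.2.
  by move=> aE; apply: connect1; rewrite /edge -surjective_pairing aE.
have c1 a : a \in E1 -> connect (edge E1) a.1 a.2.
  by move=> aE; apply: connect1; rewrite /edge -surjective_pairing aE.
have ru : r u = u by rewrite /r (negPf uv).
have rw : r w = w by rewrite /r (negPf wv).
have rv : r v = u by rewrite /r eqxx.
have step12 a : a \in E1 -> connect (edge E2) (r a.1) (r a.2).
  rewrite !inE => /or3P[/eqP->|/eqP->|aE] /=.
  - by rewrite ru rv.
  - by rewrite rv rw; apply: (c2 (u, w)); rewrite mem_head.
  - by have [-> ->] := rE a aE; apply: c2; rewrite inE aE orbT.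
have step21 a : a \in E2 -> connect (edge E1) a.1 a.2.
  rewrite inE => /predU1P[->|aE] /=; last by apply: c1; rewrite !inE aE !orbT.
  apply: (@connect_trans _ _ v); first by apply: (c1 (u, v)); rewrite mem_head.
  by apply: (c1 (v, w)); rewrite !inE eqxx orbT.
have sub12 x' y' : edge E1 x' y' -> connect (edge E2) (r x') (r y').
  case/orP=> [/step12 //|/step12]; by rewrite edge_connect_sym.
have sub21 x' y' : edge E2 x' y' -> connect (edge E1) x' y'.
  case/orP=> [/step21 //|/step21]; by rewrite edge_connect_sym.
have xr z : connect (edge E1) z (r z).
  rewrite /r; case: eqP => [->|_]; last exact: connect0.
  by rewrite edge_connect_sym; apply: (c1 (u, v)); rewrite mem_head.
apply/idP/idP => [/connectP[p + ->]|].
  elim: p x => [|z p IHp] x /=; first by rewrite connect0.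
  by case/andP=> /sub12 xz /IHp; apply: connect_trans.
move=> rxy; apply: connect_trans (xr x) _; rewrite edge_connect_sym.
apply: connect_trans (xr y) _; rewrite edge_connect_sym.
by apply: connect_sub rxy => x' y'; apply: sub21.
Qed.

(** With [u] in [S], the component of [v] is still represented once [v] is removed. *)
Lemma components_contract O S : v \notin O -> u \in S ->
  components_avoiding O (edge E1) S = components_avoiding O (edge E2) (S :\ v).
Proof.
move=> vO uS; pose f x := [set y | connect (edge E2) x y].
set S1 := [set x in S | [forall o in O, ~~ connect (edge E1) x o]].
transitivity #|[set f (r x) | x in S1]|.
  apply: card_imset_kernel => x y _ _.
  by rewrite !same_component connect_contract.
rewrite /components_avoiding (imset_comp f r).
have avoid x : [forall o in O, ~~ connect (edge E1) x o] =
    [forall o in O, ~~ connect (edge E2) (r x) o].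
  apply: eq_forallb => o; case oO: (o \in O) => //=.
  rewrite connect_contract (_ : r o = o) // /r; case: eqP => // ov.
  by rewrite ov (negPf vO) in oO.
suff -> : r @: S1 =
  [set x in S :\ v | [forall o in O, ~~ connect (edge E2) x o]] by [].
apply/setP=> x; rewrite !inE -andbA; apply/imsetP/and3P => [[z]|[xv xS xO]].
  rewrite !inE avoid => /andP[zS zO] ->; split=> //.
    by rewrite /r; have [|] := eqVneq z v.
  by rewrite /r; case: ifP.
exists x; last by rewrite /r (negPf xv).
by rewrite !inE avoid xS /r (negPf xv).
Qed.

End ContractVertex.

Section LoopVertex.
Variables (v : Y) (E : seq (Y * Y)).
Hypothesis vE : v \notin endpoints E.

Lemma connect_isolated y : connect (edge E) v y = (v == y).
Proof.
apply/idP/eqP => [/connectP[[|z p] /=]|->]; [by []| |exact: connect0].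
by case/andP=> /orP[]/mem_endpoints[]/= a b; have := vE; rewrite ?a ?b.
Qed.

Lemma connect_loop : connect (edge ((v, v) :: E)) =2 connect (edge E).
Proof.
move=> x y; apply/idP/idP; apply: connect_sub => {}x {}y.
  rewrite /edge !inE !xpair_eqE orbACA => /orP[|xy]; last exact: connect1.
  by case/orP=> /andP[/eqP-> /eqP->].
by move=> xy; apply: connect1; move: xy; rewrite /edge !inE => /orP[]->;
  rewrite !orbT.
Qed.

Lemma components_loop O S : v \in S -> v \notin O ->
  components_avoiding O (edge ((v, v) :: E)) S =
  (components_avoiding O (edge E) (S :\ v)).+1.
Proof.
move=> vS vO; rewrite (eq_components_avoiding _ _ connect_loop).
rewrite /components_avoiding.
pose f x := [set y | connect (edge E) x y].
have -> : [set x in S | [forall o in O, ~~ connect (edge E) x o]] =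
    v |: [set x in S :\ v | [forall o in O, ~~ connect (edge E) x o]].
  apply/setP=> x; rewrite !inE; have [->|//] := eqVneq x v.
  rewrite vS /=; apply/forall_inP => o oO; rewrite connect_isolated.
  by apply: contraNneq vO => ->.
rewrite imsetU1 cardsU1 (_ : _ \notin _) //; apply/imsetP=> -[x].
rewrite !inE -andbA => /and3P[xv _ _] /eqP.
by rewrite same_component connect_isolated eq_sym (negPf xv).
Qed.

End LoopVertex.

End Multigraph.

(** * Elimination of the middle nodes *)

Section SameArcs.
Variable T : eqType.
Implicit Types (a b : T * T) (A B C : seq (T * T)).

Definition has_arc A a := (a \in A) || (flip_arc a \in A).

Definition same_arcs A B :=
  [/\ size A = size B, perm_eq (endpoints A) (endpoints B) &
      has_arc A =1 has_arc B].

Lemma same_arcs_trans A B C : same_arcs A B -> same_arcs B C -> same_arcs A C.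
Proof.
move=> [s p h] [s' p' h']; split; [by rewrite s | exact: perm_trans p' | ].
by move=> a; rewrite h.
Qed.

Lemma same_arcs_cons a A B : same_arcs A B -> same_arcs (a :: A) (a :: B).
Proof.
case=> s p h; split; rewrite /= ?s // ?perm_cons // => b.
by have := h b; rewrite /has_arc !inE !orbA !(orbAC _ _ (flip_arc b == a))
  -!orbA => ->.
Qed.

Lemma same_arcs_flip a A : same_arcs (a :: A) (flip_arc a :: A).
Proof.
split=> // [|b]; first exact: (permEl (perm_catCA [:: a.1] [:: a.2] _)).
rewrite /has_arc !inE orbACA [in RHS]orbACA; congr (_ || _).
by case: a b => [s t] [u v]; rewrite /flip_arc /= !xpair_eqE orbC
  ![(v == _) && _]andbC.
Qed.

Lemma same_arcs_perm A B : perm_eq A B -> same_arcs A B.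
Proof.
move=> p; split; [exact: perm_size | exact: perm_endpoints | ].
by move=> a; rewrite /has_arc !(perm_mem p).
Qed.

Lemma same_arcs_front x A : x \in endpoints A -> exists y B,
  same_arcs A ((y, x) :: B).
Proof.
case/endpointsP=> a aA xa; have p := perm_to_rem aA.
have := same_arcs_perm p; case: a {aA p} xa => s t /= /orP[]/eqP<- pA.
  by exists t, (rem (x, t) A); apply: same_arcs_trans pA (same_arcs_flip _ _).
by exists s, (rem (s, x) A).
Qed.

End SameArcs.

Section Stacking.
Variables k l m : nat.

(* The nodes of two diagrams before gluing, the lower diagram being the left   *)
(* summand.                                                                    *)
Definition stacked : finType := (node k l + node l m)%type.

Definition vertex (w : stacked) : glued k l m :=
  match w with inl x => below m x | inr x => above k x end.

(** [hi j] and [lo j] are the two copies of the middle node [j]: at the top of the lower diagram and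
    at the bottom of the upper one. *)
Definition hi (j : 'I_l) : stacked := inl (inr j).
Definition lo (j : 'I_l) : stacked := inr (inl j).
Definition mid (j : 'I_l) : glued k l m := inl (inr j).

Definition outside : {set glued k l m} := ~: [set mid j | j : 'I_l].

Definition remaining (s : seq 'I_l) : {set glued k l m} :=
  outside :|: [set mid j | j in s].

Lemma vertex_mid w j : (vertex w == mid j) = (w == hi j) || (w == lo j).
Proof.
apply/eqP/orP=> [|[]/eqP->//].
by case: w => [] [] i // [->]; [left | right]; rewrite eqxx.
Qed.

End Stacking.

Arguments hi {k l m} j.
Arguments lo {k l m} j.
Arguments mid {k l m} j.

Lemma eq_hi k l m i j : (hi i == hi j :> stacked k l m) = (i == j).
Proof. by []. Qed.
Lemma eq_lo k l m i j : (lo i == lo j :> stacked k l m) = (i == j).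
Proof. by []. Qed.
Lemma eq_hi_lo k l m i j : (hi i == lo j :> stacked k l m) = false.
Proof. by []. Qed.

Definition node_up k l (x : node k l) : bool :=
  match x with inl _ => false | inr _ => true end.

(* Nodes are ordered counterclockwise, starting from the lower left corner. *)
Definition node_rank k l (x : node k l) : nat :=
  match x with inl i => i | inr j => k + (l - j.+1) end.

Definition stacked_up k l m (w : stacked k l m) : bool :=
  match w with inl x => node_up x | inr x => node_up x end.

(** The lower order ends with the middle nodes from right to left, the upper order begins with them
    from left to right. The pairs [hi j], [lo j] are therefore nested, with [j] = 0 innermost. *)
Definition stacked_rank k l m (w : stacked k l m) : nat :=
  match w with inl x => node_rank x | inr x => (k + l) + node_rank x end.

Lemma node_rank_lt k l (x : node k l) : (node_rank x < k + l)%N.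
Proof. by case: x => i /=; have := ltn_ord i; lia. Qed.

Lemma node_rank_inj k l : injective (@node_rank k l).
Proof.
move=> [] i [] j /= E; try (congr inl || congr inr); try apply/val_inj => /=;
  by have := ltn_ord i; have := ltn_ord j; lia.
Qed.

Lemma stacked_rank_inj k l m : injective (@stacked_rank k l m).
Proof.
move=> [] x [] y /=.
- by move/node_rank_inj->.
- by have := node_rank_lt x; lia.
- by have := node_rank_lt y; lia.
- by move/addnI/node_rank_inj->.
Qed.

Lemma rank_between k l m (j : 'I_l) (z : stacked k l m) :
  (forall i : 'I_l, (i <= j)%N -> z != hi i /\ z != lo i) ->
  (stacked_rank z < stacked_rank (hi j : stacked k l m))%N =
  (stacked_rank z < stacked_rank (lo j : stacked k l m))%N.
Proof.
have jl := ltn_ord j.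
have lt_ij (i : 'I_l) : (i <= j -> z != hi i /\ z != lo i)%N ->
    (z == hi i) || (z == lo i) -> (j < i)%N.
  by move=> ij; rewrite ltnNge => /orP[]/eqP zE; apply/negP => /ij;
    rewrite zE !eqxx; case.
case: z lt_ij => [] [] i /= lt_ij nz; have := ltn_ord i.
- by lia.
- by have := lt_ij i (nz i); rewrite eqxx => /(_ isT); lia.
- by have := lt_ij i (nz i); rewrite eqxx ?orbT => /(_ isT); lia.
- by lia.
Qed.

Section Elimination.
Variables (K : fieldType) (V : superspace K) (beta : {biscalar V}).
Hypothesis beta_osp : orthosymplectic beta.
Hypothesis beta_nd : nondegenerate_form beta.
Local Notation n := (bdim V).
Variables k l m : nat.
Local Notation stacked := (stacked k l m).
Local Notation glued := (glued k l m).
Local Notation vertex := (@vertex k l m).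
Local Notation amp := (amp beta (@stacked_rank k l m) (@stacked_up k l m)).
Implicit Types (A : seq (stacked * stacked)) (c : {ffun glued -> 'I_n}).

Lemma same_amp A B (c : stacked -> 'I_n) :
  same_arcs A B -> uniq (endpoints A) -> amp A c = amp B c.
Proof.
case=> s p h uA; apply: (amp_listing beta_osp beta_nd _
  (@stacked_rank_inj k l m)) => //.
  by rewrite -(perm_uniq p).
by move=> a aA; rewrite -/(has_arc B a) -h /has_arc aA.
Qed.

Definition arc_edges A : seq (glued * glued) :=
  [seq (vertex a.1, vertex a.2) | a <- A].

Lemma edge_has_arc A u v : edge (arc_edges A) u v =
  [exists a : stacked * stacked,
     [&& has_arc A a, vertex a.1 == u & vertex a.2 == v]].
Proof.
apply/orP/existsP => [[]/mapP[a aA [-> ->]]|[a /and3P[/orP[]aA /eqP<- /eqP<-]]].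
- by exists a; rewrite !eqxx /has_arc aA.
- by exists (flip_arc a); rewrite !eqxx /has_arc /flip_arc /=
    -surjective_pairing aA orbT.
- by left; apply: map_f aA.
- by right; apply: (map_f _ aA).
Qed.

Lemma same_connect A B : same_arcs A B ->
  connect (edge (arc_edges A)) =2 connect (edge (arc_edges B)).
Proof.
case=> _ _ h; apply: eq_connect => u v; rewrite !edge_has_arc.
by apply: eq_existsb => a; rewrite h.
Qed.

Definition extends (s : seq 'I_l) c0 c : bool :=
  [forall y, (y \notin [set mid j | j in s]) ==> (c y == c0 y)].

Definition update c (v : glued) i : {ffun glued -> 'I_n} :=
  [ffun y => if y == v then i else c y].

Lemma mid_inj : injective (@mid k l m). Proof. by move=> i j []. Qed.

Lemma sum_extends (j : 'I_l) s c0 (F : {ffun glued -> 'I_n} -> K) : j \notin s ->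
  \sum_(c | extends (j :: s) c0 c) F c =
  \sum_(c | extends s c0 c) \sum_i F (update c (mid j) i).
Proof.
move=> js; rewrite pair_big_dep /=.
have midE y : y \notin [set mid j' | j' in j :: s] =
    (y != mid j) && (y \notin [set mid j' | j' in s]).
  rewrite -negb_or; congr (~~ _); apply/imsetP/orP =>
    [[j']|[/eqP->|/imsetP[j' j's ->]]].
  - by rewrite inE => /predU1P[-> ->|j's ->]; [left | right; apply/imsetP;
      exists j'].
  - by exists j; rewrite ?mem_head.
  - by exists j'; rewrite // inE j's orbT.
have js' : (mid j : glued) \notin [set mid j' | j' in s].
  by apply/imsetP=> -[j' j's /mid_inj jj']; rewrite jj' j's in js.
rewrite (reindex_onto (fun p : {ffun glued -> 'I_n} * 'I_n =>
  update p.1 (mid j) p.2)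
  (fun c => (update c (mid j) (c0 (mid j)), c (mid j)))) /= => [|c _]; last first.
  by apply/ffunP=> y; rewrite !ffunE; case: eqP => [->|].
apply: eq_bigl => -[c i] /=; rewrite andbT; apply/andP/forallP =>
  [[/forallP cc0 /eqP[E _]] y|cc0].
  apply/implyP=> ys; have [->|yj] := eqVneq y (mid j).
    by rewrite -E ffunE eqxx.
  by have := cc0 y; rewrite midE yj ys ffunE (negPf yj).
split.
  apply/forallP=> y; apply/implyP; rewrite midE ffunE => /andP[/negPf-> ys].
  exact: (implyP (cc0 y)).
apply/eqP; congr pair; last by rewrite ffunE eqxx.
apply/ffunP=> y; rewrite !ffunE.
by case: eqP => // ->; apply/esym/eqP/(implyP (cc0 _)).
Qed.

(** Induction on [s], whose head [j] is the smallest remaining index and so the innermost pair. Its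
    copies are either the two ends of one arc, a closed loop, or lie on two arcs, which get joined.
    Tracking connectivity identifies [N], the exponent of [sdim V], with the number of components
    that avoid the outer nodes. *)
Lemma eliminate (s : seq 'I_l) A :
  sorted ltn (map val s) -> uniq (endpoints A) ->
  (forall j, (hi j \in endpoints A) = (j \in s)) ->
  (forall j, (lo j \in endpoints A) = (j \in s)) ->
  exists A' N,
    [/\ uniq (endpoints A'),
        forall w, (w \in endpoints A') =
          (w \in endpoints A) && (vertex w \in outside k l m),
        forall c0, \sum_(c | extends s c0 c) amp A (c \o vertex) =
          (sdim V)%:~R ^+ N * amp A' (c0 \o vertex),
        {in A', forall a,
           connect (edge (arc_edges A)) (vertex a.1) (vertex a.2)} &
        components_avoiding (outside k l m) (edge (arc_edges A))
          (remaining k m s) = N].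
Proof.
have mid_outside j : mid j \notin outside k l m.
  by rewrite inE negbK; apply: imset_f.
have vertex_outside w : (vertex w \in outside k l m) =
    ~~ [exists j, (w == hi j) || (w == lo j)].
  rewrite inE; congr (~~ _); apply/imsetP/existsP => [[j _ /eqP]|[j]].
    by rewrite vertex_mid; exists j.
  by rewrite -vertex_mid => /eqP->; exists j.
elim: s A => [|j s IHs] A ss uA hiA loA.
  exists A, 0%N; split=> //.
  - move=> w; rewrite vertex_outside; case wA: (w \in _) => //=.
    apply/esym/existsPn=> j; apply/norP; split; apply: contraTneq wA => ->;
      by rewrite ?hiA ?loA.
  - move=> c0; rewrite mul1r (big_pred1 c0) // => c /=.
    apply/forallP/eqP=> [cc0|->] => [|y]; last by rewrite eqxx implybT.
    apply/ffunP=> y; apply/eqP/(implyP (cc0 y)).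
    by apply/imsetP=> -[].
  - move=> a aA; apply: connect1.
    by apply/orP; left; apply: (map_f (fun a : stacked * stacked =>
      (vertex a.1, vertex a.2))).
  - apply: components_avoiding_sub; apply/subsetP=> y; rewrite in_setU.
    by case/orP=> // /imsetP[].
have js : j \notin s.
  by have := sorted_uniq ltn_trans ltnn ss; rewrite /= mem_map => [/andP[]//|];
    exact: val_inj.
have lt_js j' : j' \in s -> (j < j')%N.
  move=> j's; have := ss; rewrite /= (path_sortedE ltn_trans) =>
    /andP[/allP/(_ (val j')) -> //].
  exact: map_f.
have {}ss : sorted ltn (map val s) by move/path_sorted: ss.
(* Indices below [j] are not in [j :: s], so their copies no longer occur in [A] and nothing is left
   between [hi j] and [lo j]. *)
have rank_j z : z \in endpoints A -> z != hi j -> z != lo j ->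
    (stacked_rank z < stacked_rank (hi j : stacked))%N =
      (stacked_rank z < stacked_rank (lo j : stacked))%N.
  move=> zA zhi zlo; apply: rank_between => i;
    rewrite leq_eqVlt => /predU1P[/val_inj->//|ij].
  have is' : i \notin j :: s.
    rewrite inE negb_or -(inj_eq val_inj) neq_ltn ij /=.
    by apply: contraL ij => /lt_js; rewrite -leqNgt => /ltnW.
  by split; apply: contraNneq is' => zE; rewrite zE ?hiA ?loA in zA.
have lt_hilo : (stacked_rank (hi j : stacked) < stacked_rank (lo j : stacked))%N.
  by rewrite /=; have := ltn_ord j; lia.
pose upd c i := update c (mid j) i \o vertex.
have upd_hi c i : upd c i (hi j) = i by rewrite /upd /= ffunE eqxx.
have upd_lo c i : upd c i (lo j) = i by rewrite /upd /= ffunE eqxx.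
have upd_z c z i : z != hi j -> z != lo j -> upd c i z = (c \o vertex) z.
  by move=> /negPf zh /negPf zl; rewrite /upd /= ffunE vertex_mid zh zl.
have [a [A1 same1]] : exists a A1, same_arcs A ((a, hi j) :: A1).
  by apply: same_arcs_front; rewrite hiA mem_head.
have v_out : (mid j : glued) \notin outside k l m by apply: mid_outside.
have v_in : mid j \in remaining k m (j :: s).
  by rewrite in_setU; apply/orP; right; apply: imset_f; rewrite mem_head.
have remE : remaining k m (j :: s) :\ mid j = remaining k m s.
  apply/setP=> y; rewrite in_setD1 !in_setU.
  apply/andP/orP=> [[yv /orP[->|/imsetP[j' + yE]]]|[yo|/imsetP[j' j's ->]]].
  - by left.
  - rewrite inE => /predU1P[E|j's]; first by rewrite yE E eqxx in yv.
    by right; rewrite yE; apply: imset_f.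
  - by rewrite yo; split=> //; apply: contraTneq yo => ->.
  - rewrite (inj_eq mid_inj) imset_f ?inE ?j's ?orbT //; split=> //.
    by apply: contraNneq js => <-.
have v_ends B : hi j \notin endpoints B -> lo j \notin endpoints B ->
    mid j \notin endpoints (arc_edges B).
  move=> hB lB; rewrite endpoints_map; apply/mapP=> -[z zB /esym/eqP].
  by rewrite vertex_mid => /orP[]/eqP zE; rewrite -zE zB in hB lB.
have out_neq w : vertex w \in outside k l m -> w != hi j /\ w != lo j.
  by move=> wo; split; apply: contraTneq wo => ->.
(* First case: the arc at [hi j] ends at [lo j] and closes a loop. In the second case [lo j] lies on
   another arc, with far end [b]. *)
have [aE|a_lo] := eqVneq a (lo j).
  have {}same1 : same_arcs A ((hi j, lo j) :: A1).
    by apply: same_arcs_trans same1 _; rewrite aE; apply: same_arcs_flip.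
  have [_ p1 _] := same1; have := uA.
  rewrite (perm_uniq p1) /= inE negb_or => /and3P[/andP[_ hi1] lo1 uA1].
  have memA z :
      (z \in endpoints A) = [|| z == hi j, z == lo j | z \in endpoints A1].
    by rewrite (perm_mem p1) /= !inE.
  have [j' | j' | A' [N [uA' memA' sumA' conA' compA']]] := IHs A1 ss uA1.
  - have [->|jj'] := eqVneq j' j; first by rewrite (negPf hi1) (negPf js).
    by have := hiA j'; rewrite memA eq_hi eq_hi_lo inE (negPf jj') /= => <-.
  - have [->|jj'] := eqVneq j' j; first by rewrite (negPf lo1) (negPf js).
    by have := loA j'; rewrite memA eq_sym eq_hi_lo eq_lo inE (negPf jj') /= => <-.
  have conA : connect (edge (arc_edges A)) =2 connect (edge (arc_edges A1)).
    by move=> u w; rewrite (same_connect same1) connect_loop.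
  exists A', N.+1; split=> //.
  - move=> w; rewrite memA' memA; case wo: (vertex w \in _);
      rewrite ?andbF // !andbT.
    by have [/negPf-> /negPf->] := out_neq _ wo.
  - move=> c0; rewrite (sum_extends _ _ js) exprS -mulrA -sumA' mulr_sumr.
    apply: eq_bigr => c _.
    rewrite -(amp_loop _ (x := hi j) (y := lo j) (ci := upd c)) //.
    + by apply: eq_bigr => i _; apply: same_amp.
    + by move=> z z1; apply: rank_j; rewrite ?memA ?z1 ?orbT //;
        apply: contraTneq z1 => ->.
    + by move=> z z1 i; apply: upd_z; apply: contraTneq z1 => ->.
  - by move=> e eA'; rewrite conA conA'.
  - rewrite (eq_components_avoiding _ _ (same_connect same1)) /=.
    by rewrite components_loop ?v_ends // remE compA'.
have lo1 : lo j \in endpoints A1.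
  have [_ p1 _] := same1; have := loA j.
  by rewrite (perm_mem p1) mem_head /= !inE eq_sym (negPf a_lo)
    [lo j == hi j]eq_sym eq_hi_lo.
have [b [A2 same2]] := same_arcs_front lo1.
have {}same2 : same_arcs A [:: (a, hi j), (lo j, b) & A2].
  apply: same_arcs_trans same1 _; apply: same_arcs_cons.
  by apply: same_arcs_trans same2 _; apply: same_arcs_flip.
have [_ p2 _] := same2; have u2 := uA; rewrite (perm_uniq p2) in u2.
have memA z : (z \in endpoints A) =
    [|| z == a, z == hi j, z == lo j, z == b | z \in endpoints A2].
  by rewrite (perm_mem p2) /= !inE.
have := u2; rewrite /= !inE !negb_or.
move=> /and5P[/and4P[a_hi _ ab a2] /and3P[_ hib hi2] /andP[lob lo2] b2 uA2].
have memA3 z : (z \in endpoints ((a, b) :: A2)) =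
    [&& z \in endpoints A, z != hi j & z != lo j].
  rewrite memA /= !inE.
  have [->|_] := eqVneq z (hi j).
    by rewrite eq_sym (negPf a_hi) (negPf hib) (negPf hi2) !andbF.
  have [->|_] := eqVneq z (lo j); last by rewrite !andbT.
  by rewrite eq_sym (negPf a_lo) (negPf lob) (negPf lo2) !andbF.
have [|j'|j'|A' [N [uA' memA' sumA' conA' compA']]] := IHs ((a, b) :: A2) ss.
- by rewrite /= inE negb_or ab a2 b2.
- rewrite memA3 hiA inE eq_hi eq_hi_lo.
  by have [->|_] := eqVneq j' j; rewrite ?(negPf js) /= ?andbT.
- rewrite memA3 loA inE eq_lo [lo j' == _]eq_sym eq_hi_lo.
  by have [->|_] := eqVneq j' j; rewrite ?(negPf js) /= ?andbT.
have vertex_neq z : z != hi j -> z != lo j -> vertex z != mid j.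
  by move=> /negPf zh /negPf zl; rewrite vertex_mid zh zl.
have av : vertex a != mid j by apply: vertex_neq.
have bv : vertex b != mid j by apply: vertex_neq; rewrite eq_sym.
have conA u w : connect (edge (arc_edges A)) u w =
    connect (edge [:: (vertex a, mid j), (mid j, vertex b) & arc_edges A2]) u w.
  exact: (same_connect same2).
exists A', N; split=> //.
- move=> w; rewrite memA' memA3; case wo: (vertex w \in _);
    rewrite ?andbF // !andbT.
  by have [-> ->] := out_neq _ wo; rewrite /= ?andbT.
- move=> c0; rewrite (sum_extends _ _ js) -sumA'.
  apply: eq_bigr => c _.
  rewrite -(amp_contract beta_osp beta_nd (@stacked_rank_inj k l m)
    (x := hi j) (y := lo j) (ci := upd c)) //.
  + by apply: eq_bigr => i _; apply: same_amp.
  + by move=> z; rewrite -[[:: a, b & _]]/(endpoints ((a, b) :: A2)) memA3 =>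
      /and3P[zA zh zl]; apply: rank_j.
  + by move=> z; rewrite -[[:: a, b & _]]/(endpoints ((a, b) :: A2)) memA3 =>
      /and3P[zA zh zl] i; apply: upd_z.
- move=> e eA'; rewrite conA connect_contract ?v_ends //.
  have [] := mem_endpoints eA'; rewrite !memA' => /andP[_ o1] /andP[_ o2].
  have [/vertex_neq h1 /h1/negPf->] := out_neq _ o1.
  have [/vertex_neq h2 /h2/negPf->] := out_neq _ o2.
  exact: conA'.
rewrite (eq_components_avoiding _ _ conA) components_contract ?v_ends //.
  by rewrite remE compA'.
(* The vertex of [a] is outer, or [a] is a copy of a middle node; as [a] is an endpoint of [A], the
   index of that node lies in [j :: s]. *)
rewrite in_setU vertex_outside; case: existsP => //= -[j'].
rewrite -vertex_mid => /eqP vE; rewrite vE; apply: imset_f.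
have aA : a \in endpoints A by rewrite memA eqxx.
by have := eqxx (vertex a); rewrite {2}vE vertex_mid => /orP[]/eqP aE;
  rewrite aE ?hiA ?loA in aA.
Qed.

End Elimination.

(** * The linear map of a diagram *)

Section Listing.
Variables k l : nat.
Implicit Types (D : diagram k l) (A : seq (node k l * node k l)).

Definition listing D A : bool :=
  [&& uniq (endpoints A), [forall x, x \in endpoints A] &
      all (fun a => [set a.1; a.2] \in arcs D) A].

Lemma exists_listing D : exists A, listing D A.
Proof.
have [A EA] : exists A, [seq [set a.1; a.2] | a <- A] = enum (arcs D).
  have : {subset enum (arcs D) <= arcs D} by move=> e; rewrite mem_enum.
  elim: (enum _) => [_|e es IHes sub]; first by exists [::].
  have [|A <-] := IHes; first by move=> f fs; apply: sub; rewrite inE fs orbT.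
  have [x [y ->]] := arc_endpoints (arcsP D) (sub e (mem_head _ _)).
  by exists ((x, y) :: A).
have mem_A a : a \in A -> [set a.1; a.2] \in arcs D.
  by move=> aA; rewrite -mem_enum -EA; apply: (map_f (fun a => [set a.1; a.2])).
have sub x : x \in endpoints A.
  have /pairingP[_ /(_ x)[e eD xe] _] := arcsP D; move: eD xe.
  rewrite -mem_enum -EA => /mapP[a /mem_endpoints[a1 a2] ->].
  by case/set2P=> ->.
(* The endpoints cover all nodes and their number is twice that of the arcs, which is the number of
   nodes; hence there are no repetitions. *)
exists A; apply/and3P; split; last exact/allP.
  apply: (leq_size_uniq (enum_uniq (node k l))) => [x _|]; first exact: sub.
  rewrite size_endpoints -(size_map (fun a => [set a.1; a.2])) EA -!cardE.
  have /andP[pD /forall_inP D2] := arcsP D.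
  rewrite -cardsT (card_uniform_partition _ pD (n := 2)) ?muln2 // => e eD.
  exact/eqP/D2.
exact/forallP.
Qed.

Definition arc_list D := xchoose (exists_listing D).

Lemma arc_listP D : listing D (arc_list D).
Proof. exact: xchooseP. Qed.

Lemma listing_has_arc D A x y : listing D A -> [set x; y] \in arcs D ->
  has_arc A (x, y).
Proof.
case/and3P=> _ /forallP/(_ x)/endpointsP[a aA xa] /allP/(_ a aA) aD xyD.
case: a aA xa aD => s t /= stA /orP[]/eqP xE stD; subst x.
  by rewrite /has_arc (arc_unique (arcsP D) xyD stD) stA.
rewrite setUC in stD.
by rewrite /has_arc /flip_arc /= (arc_unique (arcsP D) xyD stD) stA orbT.
Qed.

Lemma size_listing D A : listing D A -> (size A).*2 = #|node k l|.
Proof.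
case/and3P=> uA /forallP cA _; rewrite -size_endpoints -(card_uniqP uA).
by apply: eq_card => x; rewrite cA.
Qed.

End Listing.

Lemma listing_juxt k l k' l' (D : diagram k l) (D' : diagram k' l') A A' :
  listing D A -> listing D' A' ->
  listing (juxt D D')
    ([seq (left_node k' l' a.1, left_node k' l' a.2) | a <- A] ++
     [seq (right_node k l a.1, right_node k l a.2) | a <- A']).
Proof.
case/and3P=> uA /forallP cA /allP aA /and3P[uA' /forallP cA' /allP aA'].
rewrite /listing endpoints_cat !endpoints_map; apply/and3P; split.
- rewrite cat_uniq !map_inj_uniq ?uA ?uA' /= ?andbT; last 2 first.
    exact: right_node_inj.
  exact: left_node_inj.
  apply/hasPn=> _ /mapP[y _ ->]; apply/mapP=> -[x _ /esym/eqP].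
  by rewrite (negPf (left_right_node _ _)).
- apply/forallP=> z; rewrite mem_cat; case: (node_split z) => -[x ->].
    by rewrite map_f.
  by rewrite (map_f (@right_node k l k' l')) ?orbT.
- rewrite all_cat; apply/andP; split; apply/allP=> _ /mapP[a aL ->] /=.
    exact: mem_juxt_left (aA a aL).
  exact: mem_juxt_right (aA' a aL).
Qed.

Section DiagramMap.
Variables (K : fieldType) (V : superspace K) (beta : {biscalar V}).
Hypothesis beta_osp : orthosymplectic beta.
Hypothesis beta_nd : nondegenerate_form beta.
Local Notation n := (bdim V).

Definition colouring k l (I : midx V k) (L : midx V l) (x : node k l) : 'I_n :=
  match x with inl i => I i | inr j => L j end.

Definition coef k l (D : diagram k l) (c : node k l -> 'I_n) : K :=
  amp beta (@node_rank k l) (@node_up k l) (arc_list D) c.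

Lemma coef_listing k l (D : diagram k l) A c : listing D A ->
  coef D c = amp beta (@node_rank k l) (@node_up k l) A c.
Proof.
move=> lA; have lD := arc_listP D; have /and3P[uD _ /allP aD] := lD.
have /and3P[uA _ _] := lA.
apply: (amp_listing beta_osp beta_nd _ (@node_rank_inj k l)) => //.
  by apply: double_inj; rewrite !(@size_listing _ _ D).
by move=> [x y] /aD /= /(listing_has_arc lA).
Qed.

Definition diag_map k l (D : diagram k l) : 'Hom(tpow V k, tpow V l) :=
  textend (fun I => [ffun L => coef D (colouring I L)]).

Lemma diag_mapE k l (D : diagram k l) I L :
  diag_map D (tbasis I) L = coef D (colouring I L).
Proof. by rewrite textendE ffunE. Qed.

Lemma hom_eqP r s (f g : 'Hom(tpow V r, tpow V s)) :
  (forall I L, f (tbasis I) L = g (tbasis I) L) -> f = g.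
Proof.
move=> fg; apply/lfunP=> t; apply/ffunP=> L; rewrite !hom_coord.
by apply: eq_bigr => I _; rewrite fg.
Qed.

(** In the circular order the nodes of [D'] form an interval between the lower and the upper nodes
    of [D], so arcs of [D] and of [D'] never interleave. *)
Lemma diag_map_juxt k l k' l' (D : diagram k l) (D' : diagram k' l') :
  diag_map (juxt D D') = tens_hom (diag_map D) (diag_map D').
Proof.
apply: hom_eqP => I L; rewrite diag_mapE textendE ffunE !diag_mapE.
rewrite (coef_listing _ (listing_juxt (arc_listP D) (arc_listP D'))) amp_cat.
  rewrite /coef; congr (_ * _).
    apply: (@amp_map K V beta _ _ (@node_rank k l) _ _ _
      (@left_node k l k' l')) => [[i|i] [j|j]|[i|i]|[i|i]] //=;
      rewrite ?ffunE //; have := ltn_ord i; have := ltn_ord j; lia.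
  apply: (@amp_map K V beta _ _ (@node_rank k' l') _ _ _
    (@right_node k l k' l')) => [[i|i] [j|j]|[i|i]|[i|i]] //=;
    rewrite ?ffunE //; have := ltn_ord i; have := ltn_ord j; lia.
move=> _ _ /mapP[a _ ->] /mapP[b _ ->]; rewrite /crosses /=.
case: a b => [[i|i] [j|j]] [[u|u] [v|v]] /=;
  have := ltn_ord i; have := ltn_ord j; have := ltn_ord u; have := ltn_ord v; lia.
Qed.

(** * Composites and closed loops *)

Section Composition.
Variables (k l m : nat) (D1 : diagram l m) (D2 : diagram k l).
Let A : seq (stacked k l m * stacked k l m) :=
  [seq (inl a.1, inl a.2) | a <- arc_list D2] ++
  [seq (inr a.1, inr a.2) | a <- arc_list D1].

Definition outer_stacked (x : node k m) : stacked k l m :=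
  match x with inl i => inl (inl i) | inr j => inr (inr j) end.

Lemma vertex_outer_stacked x : vertex (outer_stacked x) = outer l x.
Proof. by case: x. Qed.

Lemma outer_stacked_inj : injective outer_stacked.
Proof. by case=> i [] j //= [->]. Qed.

Lemma outsideE (w : stacked k l m) :
  vertex w \in outside k l m -> exists x, w = outer_stacked x.
Proof.
rewrite inE; case: w => [] [] i /=.
- by exists (inl i).
- by move/negP; case; apply: (imset_f (@mid k l m)).
- by move/negP; case; apply: (imset_f (@mid k l m)).
- by exists (inr i).
Qed.

Lemma outsideP (y : glued k l m) :
  reflect (exists x, y = outer l x) (y \in outside k l m).
Proof.
rewrite inE; apply: (iffP idP) => [|[x ->]].
  case: y => [[i|j]|i]; [by exists (inl i) | | by exists (inr i)].
  by move/negP; case; apply: (imset_f (@mid k l m)).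
by apply/imsetP=> -[j _]; case: x.
Qed.

Lemma mem_glued_arcs w : w \in endpoints A.
Proof.
rewrite endpoints_cat !endpoints_map mem_cat.
have /and3P[_ /forallP c1 _] := arc_listP D1.
have /and3P[_ /forallP c2 _] := arc_listP D2.
by case: w => w; rewrite map_f ?orbT.
Qed.

Lemma uniq_glued_arcs : uniq (endpoints A).
Proof.
have /and3P[u1 _ _] := arc_listP D1; have /and3P[u2 _ _] := arc_listP D2.
rewrite endpoints_cat !endpoints_map cat_uniq !map_inj_uniq ?u1 ?u2 /= ?andbT.
- by apply/hasPn=> _ /mapP[y _ ->]; apply/mapP=> -[].
- by move=> x y [].
- by move=> x y [].
Qed.

Lemma connect_glued_arcs :
  connect (edge (arc_edges A)) =2 connect (glued_adj D1 D2).
Proof.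
have /and3P[_ _ /allP a1] := arc_listP D1.
have /and3P[_ _ /allP a2] := arc_listP D2.
have AC a : a \in A -> connect (glued_adj D1 D2) (vertex a.1) (vertex a.2).
  rewrite mem_cat => /orP[] /mapP[b bL ->] /=; first exact: adj_below (a2 _ bL).
  exact: adj_above (a1 _ bL).
have CA a : has_arc A a -> connect (edge (arc_edges A)) (vertex a.1) (vertex a.2).
  move=> aA; apply: connect1; rewrite edge_has_arc; apply/existsP.
  by exists a; rewrite aA !eqxx.
have pair_connect (x y u v : glued k l m) : [set u; v] = [set x; y] ->
    connect (edge (arc_edges A)) x y -> connect (edge (arc_edges A)) u v.
  move=> E xy; have := set21 u v; have := set22 u v; rewrite E.
  by move=> /set2P[]-> /set2P[]->; rewrite ?connect0 // edge_connect_sym.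
move=> u v; apply/idP/idP; apply: connect_sub => {}u {}v.
  rewrite edge_has_arc => /existsP[a /and3P[/orP[]/AC aC /eqP<- /eqP<-]] //.
  by rewrite connect_glued_sym.
case/orP=> /exists_inP[e eD /eqP].
  have [x [y E]] := arc_endpoints (arcsP D2) eD; rewrite E in eD *.
  rewrite imsetU !imset_set1 => /pair_connect; apply; apply: (CA (inl x, inl y)).
  have /orP[xy|xy] := listing_has_arc (arc_listP D2) eD.
    by apply/orP; left; rewrite mem_cat (map_f (fun a => (inl a.1, inl a.2)) xy).
  apply/orP; right; rewrite mem_cat.
  by rewrite (map_f (fun a : node k l * node k l =>
    (inl a.1, inl a.2) : stacked k l m * stacked k l m) xy).
have [x [y E]] := arc_endpoints (arcsP D1) eD; rewrite E in eD *.
rewrite imsetU !imset_set1 => /pair_connect; apply; apply: (CA (inr x, inr y)).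
have /orP[xy|xy] := listing_has_arc (arc_listP D1) eD; apply/orP.
  by left; rewrite mem_cat (map_f (fun a : node l m * node l m =>
    (inr a.1, inr a.2) : stacked k l m * stacked k l m) xy) orbT.
by right; rewrite mem_cat (map_f (fun a : node l m * node l m =>
  (inr a.1, inr a.2) : stacked k l m * stacked k l m) xy) orbT.
Qed.

Lemma closed_loopsE : closed_loops D1 D2 =
  components_avoiding (outside k l m) (edge (arc_edges A))
    (remaining k m (enum 'I_l)).
Proof.
rewrite (eq_components_avoiding _ _ connect_glued_arcs) /closed_loops.
have -> : remaining k m (enum 'I_l) = [set: glued k l m].
  apply/setP=> y; rewrite in_setU !inE -implybE; apply/implyP=> /imsetP[j _ ->].
  by apply: imset_f; rewrite mem_enum.
suff -> : [set C in glued_components D1 D2 | @outer k l m @^-1: C == set0] =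
   [set [set y | connect (glued_adj D1 D2) x y] | x in
     [set x in [set: glued k l m] | [forall o in outside k l m,
        ~~ connect (glued_adj D1 D2) x o]]] by [].
have avoid (x : glued k l m) :
    (@outer k l m @^-1: [set y | connect (glued_adj D1 D2) x y] == set0) =
    [forall o in outside k l m, ~~ connect (glued_adj D1 D2) x o].
  apply/eqP/forall_inP => [/setP C0 _ /outsideP[z ->]|C0].
    by have := C0 z; rewrite !inE => ->.
  apply/setP=> z; rewrite !inE; apply/negbTE/C0/outsideP.
  by exists z.
apply/setP=> C; rewrite inE glued_componentsE; apply/andP/imsetP.
  by case=> /imsetP[x _ ->]; rewrite avoid => xo; exists x; rewrite ?inE.
by case=> x; rewrite !inE /= => xo ->; rewrite avoid xo; split=> //; apply: imset_f.
Qed.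

Definition glued_colouring (I : midx V k) (M : midx V l) (L : midx V m) :
    {ffun glued k l m -> 'I_n} :=
  [ffun y => match y with
             | inl (inl i) => I i | inl (inr j) => M j | inr j => L j
             end].

Lemma amp_glued (I : midx V k) (M : midx V l) (L : midx V m) :
  amp beta (@stacked_rank k l m) (@stacked_up k l m) A
    (glued_colouring I M L \o @vertex k l m) =
  coef D2 (colouring I M) * coef D1 (colouring M L).
Proof.
rewrite amp_cat; last first.
  move=> _ _ /mapP[a _ ->] /mapP[b _ ->]; rewrite /crosses /=.
  have lt (x : node k l) y : (k + l + y < node_rank x)%N = false.
    by apply/negbTE; rewrite -leqNgt ltnW // ltn_addr // node_rank_lt.
  by rewrite !lt.
congr (_ * _).
  apply: (@amp_map K V beta _ _ (@node_rank k l) _ _ _ inl) => // -[i|i];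
  by rewrite /= ffunE.
apply: (@amp_map K V beta _ _ (@node_rank l m) _ _ _ inr) => [x y|//|[i|i]];
  by rewrite /= ?ltn_add2l ?ffunE.
Qed.

Lemma sum_midx_extends (I : midx V k) (M0 : midx V l) (L : midx V m)
    (F : {ffun glued k l m -> 'I_n} -> K) :
  \sum_M F (glued_colouring I M L) =
  \sum_(c | extends (enum 'I_l) (glued_colouring I M0 L) c) F c.
Proof.
rewrite [RHS](reindex_onto (fun M => glued_colouring I M L)
  (fun c => [ffun j => c (mid j)])) /= => [|c /forallP cc0].
  apply: eq_bigl => M; apply/esym/andP; split.
    apply/forallP=> y; apply/implyP=> ys; rewrite !ffunE.
    case: y ys => [[i|j]|i] //= /imsetP[]; exists j => //.
    by rewrite mem_enum.
  by apply/eqP/ffunP=> j; rewrite !ffunE.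
apply/ffunP=> y; rewrite ffunE; have := implyP (cc0 y); rewrite ffunE.
case: y => [[i|j]|i]; last 2 first.
- by move=> _; rewrite ffunE.
- by move=> E; apply/esym/eqP/E; apply/imsetP=> -[].
- by move=> E; apply/esym/eqP/E; apply/imsetP=> -[].
Qed.

(** The degenerate case V = 0: the middle nodes admit no colouring, so the sum in [sum_coef] is
    empty. As there are middle nodes but no outer ones, some loop is closed and contributes
    [sdim V], which is 0. *)
Lemma zero_loops : (forall M : midx V l, False) -> (forall x : node k m, False) ->
  (sdim V)%:~R ^+ closed_loops D1 D2 = 0 :> K.
Proof.
move=> noM no.
have no_n (i : 'I_n) : False by apply: (noM [ffun=> i]).
have n0 : n = 0%N by case: (n) no_n => // n' /(_ ord0).
have /andP[/eqP d0 /eqP d1] :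
    (\dim (ss_part V false) == 0)%N && (\dim (ss_part V true) == 0)%N.
  by rewrite -addn_eq0 -[X in X == _]/n n0.
have l_gt0 : (0 < l)%N.
  by rewrite lt0n; apply/eqP=> l0; apply: noM; rewrite l0; apply: finfun; case.
rewrite /sdim d0 d1 subrr; apply/eqP; rewrite expf_eq0 eqxx andbT card_gt0.
pose y : glued k l m := mid (Ordinal l_gt0).
apply/set0Pn; exists [set z | connect (glued_adj D1 D2) y z].
rewrite inE glued_componentsE imset_f //; apply/eqP/setP=> x.
by case: (no x).
Qed.

Lemma sum_coef (I : midx V k) (L : midx V m) :
  \sum_M coef D2 (colouring I M) * coef D1 (colouring M L) =
  (sdim V)%:~R ^+ closed_loops D1 D2 * coef (diag_comp D1 D2) (colouring I L).
Proof.
have [M0 _|noM] := pickP (fun _ : midx V l => true); last first.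
  rewrite big_pred0 // zero_loops ?mul0r // => [M|x].
    by have := noM M.
  pose i := colouring I L x; have := noM [ffun=> i]; by [].
under eq_bigr => M _ do rewrite -amp_glued.
pose F (c : {ffun glued k l m -> 'I_n}) :=
  amp beta (@stacked_rank k l m) (@stacked_up k l m) A (c \o @vertex k l m).
rewrite (sum_midx_extends I M0 L F).
have [|||A' [N [uA' memA' -> conA' loopsA']]] :=
    eliminate beta_osp beta_nd (s := enum 'I_l) _ uniq_glued_arcs.
- by rewrite val_enum_ord iota_ltn_sorted.
- by move=> j; rewrite mem_glued_arcs mem_enum.
- by move=> j; rewrite mem_glued_arcs mem_enum.
rewrite closed_loopsE loopsA'; congr (_ * _).
(* The surviving arcs end at outer nodes only. Read there, they join distinct connected nodes and so
   list the arcs of the composite. *)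
have [B EB] : exists B, A' = [seq (outer_stacked b.1, outer_stacked b.2) | b <- B].
  have : {subset endpoints A' <= [pred w | vertex w \in outside k l m]}.
    by move=> w; rewrite memA' => /andP[].
  elim: (A') => [_|[a1 a2] A'' IHA sub]; first by exists [::].
  have [w wA|B ->] := IHA; first by apply: sub; rewrite !inE wA !orbT.
  have [x1 ->] := outsideE (sub a1 (mem_head _ _)).
  have [|x2 ->] := @outsideE a2; first by apply: sub; rewrite !inE eqxx orbT.
  by exists ((x1, x2) :: B).
rewrite EB (coef_listing _ (A := B)).
  apply: (@amp_map K V beta _ _ (@node_rank k m) _ _ _ outer_stacked) =>
    [[i|i] [j|j]|[i|i]|[i|i]] //=;
    rewrite ?ffunE //; have := ltn_ord i; have := ltn_ord j; lia.
have uB : uniq (endpoints B).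
  by move: uA'; rewrite EB endpoints_map (map_inj_uniq outer_stacked_inj).
apply/and3P; split=> //.
  apply/forallP=> x; rewrite -(mem_map outer_stacked_inj) -endpoints_map -EB memA'.
  by rewrite mem_glued_arcs vertex_outer_stacked; apply/outsideP; exists x.
apply/allP=> -[x y] xyB /=; apply: mem_diag_comp.
  move: xyB uB; clear; elim: B => //= b B IHB; rewrite inE => /predU1P[<-|xyB].
    by rewrite /= inE negb_or -!andbA => /andP[].
  by case/and3P=> _ _; apply: IHB.
rewrite -connect_glued_arcs -!vertex_outer_stacked.
apply: (conA' (outer_stacked x, outer_stacked y)).
by rewrite EB; apply: (map_f (fun b => (outer_stacked b.1, outer_stacked b.2)) xyB).
Qed.

Lemma diag_map_comp : (diag_map D1 \o diag_map D2)%VF =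
  (sdim V)%:~R ^+ closed_loops D1 D2 *: diag_map (diag_comp D1 D2).
Proof.
apply: hom_eqP => I L; rewrite lfunE /= hom_coord scale_lfunE ffunE diag_mapE.
rewrite -[RHS]sum_coef; apply: eq_bigr => M _; by rewrite !diag_mapE.
Qed.

End Composition.

(** * Values on the generators *)

Lemma diag_map_id0 : diag_map (diag_id 0) = \1%VF.
Proof.
apply: hom_eqP => I L; rewrite diag_mapE (@coef_listing _ _ _ [::]).
  by rewrite lfunE ffunE (_ : L = I) ?eqxx //; apply/ffunP=> -[].
by apply/and3P; split=> //; apply/forallP=> -[] [].
Qed.

Lemma diag_map_I : diag_map diag_I = \1%VF.
Proof.
apply: hom_eqP => I L; rewrite diag_mapE (@coef_listing _ _ _ [:: (inl ord0,
  inr ord0)]).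
  rewrite /= big_nil !mulr1 /arc_amp /= andbF mul1r lfunE ffunE.
  congr (nat_of_bool _)%:R; apply/eqP/eqP=> [E|->//]; apply/ffunP=> i.
  by rewrite ord1.
apply/and3P; split=> //.
  by apply/forallP=> -[] i; rewrite ord1 !inE.
by rewrite /= (mem_invol (@flipK 1) (@flip_neq 1) (inl ord0)).
Qed.

Lemma midx2_eq (I J : midx V 2) :
  (I == J) = (I ord0 == J ord0) && (I ord_max == J ord_max).
Proof.
apply/eqP/andP=> [->//|[/eqP I0 /eqP I1]]; apply/ffunP=> -[[|[]] // p].
  by rewrite (_ : Ordinal p = ord0) //; apply/val_inj.
by rewrite (_ : Ordinal p = ord_max) //; apply/val_inj.
Qed.

Lemma rev_ord0 : rev_ord (ord0 : 'I_2) = ord_max. Proof. exact/val_inj. Qed.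

Lemma ord2 (i : 'I_2) : i = ord0 \/ i = ord_max.
Proof. by case: i => [[|[]] // p]; [left | right]; apply/val_inj. Qed.

Lemma braiding_tbasis (I L : midx V 2) : braiding V (tbasis I) L =
  (-1) ^+ (par (I ord0) && par (I ord_max)) *
    ((I ord0 == L ord_max) && (I ord_max == L ord0))%:R.
Proof.
pose J : midx V 2 := [ffun i => if i == ord0 then I ord_max else I ord0].
rewrite textendE.
have -> : tens (tvec (hbasis V)`_(I ord_max)) (tvec (hbasis V)`_(I ord0)) =
    tbasis J :> tpow V 2.
  by rewrite tbasis2 !ffunE.
by rewrite !ffunE midx2_eq !ffunE /= [(L ord0 == _) && _]andbC ![L _ == _]eq_sym.
Qed.

Lemma diag_map_X : diag_map diag_X = braiding V.
Proof.
apply: hom_eqP => I L; rewrite diag_mapE.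
rewrite (@coef_listing _ _ _ [:: (inl ord0, inr ord_max); (inl ord_max, inr ord0)]).
  rewrite /= !big_cons !big_nil !mulr1 /arc_amp /crossing /odd_arc /crosses /=.
  rewrite !andbF !mul1r /= andbT braiding_tbasis.
  have [->|_] := eqVneq (I ord0) (L ord_max); last by rewrite !mul0r mulr0.
  have [->|_] := eqVneq (I ord_max) (L ord0); last by rewrite !mulr0.
  by rewrite !mul1r !mulr1 !andbb.
apply/and3P; split=> //.
  by apply/forallP=> -[] i; have [->|->] := ord2 i; rewrite !inE.
rewrite /= -rev_ord0 (mem_invol crossK cross_neq (inl ord0)) andbT.
by have := mem_invol crossK cross_neq (inl (rev_ord ord0)); rewrite /= rev_ordK.
Qed.

Lemma diag_map_A : diag_map diag_A = contraction beta.
Proof.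
apply: hom_eqP => I L; rewrite diag_mapE (@coef_listing _ _ _ [:: (inl ord0,
  inl ord_max)]).
  by rewrite /= big_nil !mulr1 /arc_amp /= andbF mul1r textendE !ffunE [_ *:
    _]mulr1 mxE.
apply/and3P; split=> //.
  by apply/forallP=> -[i|[]//]; have [->|->] := ord2 i; rewrite !inE.
by rewrite /= -rev_ord0 (mem_invol capK cap_neq (inl ord0)).
Qed.

Lemma c0E (L : midx V 2) : c0 beta L = invmx (gram beta) (L ord0) (L ord_max).
Proof.
have lb (i j : 'I_n) : coord (hbasis V) i (hbasis V)`_j = (i == j)%:R.
  by rewrite coord_free ?(basis_free (hbasisP V)) // eq_sym.
rewrite sum_ffunE (bigD1 (L ord0)) //= big1 => [|i iL]; rewrite !ffunE.
  rewrite (_ : lshift 1 ord0 = ord0) ?lb ?eqxx ?mul1r ?addr0; last exact/val_inj.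
  rewrite (_ : rshift 1 ord0 = ord_max); last exact/val_inj.
  rewrite linear_sum (bigD1 (L ord_max)) //= linearZ /= lb eqxx mulr1.
  rewrite big1 ?addr0 // => j jL; rewrite linearZ /= lb eq_sym (negPf jL).
  exact: mulr0.
rewrite (_ : lshift 1 ord0 = ord0); last exact/val_inj.
by rewrite lb eq_sym (negPf iL) mul0r.
Qed.

Lemma diag_map_U : diag_map diag_U = cocontraction beta.
Proof.
(* The arc is listed by increasing rank, from right to left; the transposition in [wt] then restores
   the order of the indices. *)
apply: hom_eqP => I L; rewrite diag_mapE (@coef_listing _ _ _ [:: (inr ord_max,
  inr ord0)]).
  by rewrite /= big_nil !mulr1 /arc_amp /= andbF mul1r textendE c0E.
apply/and3P; split=> //.
  by apply/forallP=> -[[]//|i]; have [->|->] := ord2 i; rewrite !inE.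
by rewrite /= setUC -rev_ord0 (mem_invol cupK cup_neq (inr ord0)).
Qed.

End DiagramMap.

(** * Equivariance and the functor *)

Section Equivariance.
Variables (K : fieldType) (V : superspace K) (beta : {biscalar V}).
Hypothesis beta_osp : orthosymplectic beta.
Hypothesis beta_nd : nondegenerate_form beta.
Local Notation n := (bdim V).

Lemma even_hom r s (f : 'Hom(tpow V r, tpow V s)) :
  (forall I L, f (tbasis I) L != 0 -> tpar L = tpar I) ->
  forall d t, tpow_deg d t -> tpow_deg d (f t).
Proof.
move=> fpar d t td L; rewrite hom_coord => tL.
have /exists_inP[I _] : [exists I in predT, t I * f (tbasis I) L != 0].
  apply: contraNT tL => /exists_inPn tL; apply/eqP/big1 => I _.
  by apply/eqP; have := tL I isT; rewrite negbK.
by rewrite mulf_eq0 negb_or => /andP[/td <- /fpar].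
Qed.

Lemma tpar0 (I : midx V 0) : tpar I = false.
Proof. by rewrite /tpar big_ord0. Qed.

Lemma tpar2 (I : midx V 2) : tpar I = par (I ord0) (+) par (I ord_max).
Proof.
rewrite /tpar big_ord_recl big_ord1 oddD !oddb; congr (_ (+) par (I _)).
exact/val_inj.
Qed.

Lemma midx0_eq (I J : midx V 0) : I = J.
Proof. by apply/ffunP=> -[]. Qed.

Lemma sum_midx0 (U : nmodType) (F : midx V 0 -> U) J : \sum_I F I = F J.
Proof.
by rewrite (bigD1 J) //= big1 ?addr0 // => I; rewrite (midx0_eq I J) eqxx.
Qed.

Section Act.
Variables (A : comm_superalgebra K) (g : 'M[A]_n).

Lemma diag_act0 (I J : midx V 0) : diag_act g I J = 1.
Proof. by rewrite /diag_act !big_ord0 mul1r. Qed.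

Lemma diag_act2 (I J : midx V 2) : diag_act g I J =
  (-1) ^+ ((par (I ord0) (+) par (J ord0)) && par (I ord_max)) *
  (g (I ord0) (J ord0) * g (I ord_max) (J ord_max)).
Proof.
have E : lift ord0 ord0 = ord_max :> 'I_2 by apply/val_inj.
rewrite /diag_act !big_ord_recl !big_ord0 mulr1 !E addn0.
rewrite [X in (_ + X)%N]big_pred0 => [|[[|[]]]//]; rewrite addn0.
by rewrite big_mkcond !big_ord_recl big_ord0 /= !E addn0.
Qed.

End Act.

(** The entries of [g] supercommute, and the sign from exchanging two of them matches the signs of
    [diag_act] and of the braiding. *)
Lemma OSp_hom_braiding : OSp_hom beta (braiding V).
Proof.
split=> [|A g [gh _ _] J L].
  apply: even_hom => I L; rewrite braiding_tbasis.
  have [I0|_] := eqVneq (I ord0) (L ord_max); last by rewrite /= ?mulr0 eqxx.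
  have [I1|_] := eqVneq (I ord_max) (L ord0); last by rewrite /= ?mulr0 eqxx.
  by rewrite !tpar2 addbC I0 I1.
pose sw (I : midx V 2) : midx V 2 := [ffun i =>
  if i == ord0 then I ord_max else I ord0].
rewrite (bigD1 (sw L)) //= [RHS](bigD1 (sw J)) //= !big1 ?addr0.
- rewrite !braiding_tbasis !diag_act2 !ffunE /= !eqxx !mulr1.
  rewrite (homog_comm (gh _ _) (gh _ _)).
  rewrite !scaler_sign -!mulr_sign !mulrA -!signr_addb; congr ((-1) ^+ _ * _ * _).
  by case: (par (L ord0)) (par (L ord_max)) (par (J ord0)) (par (J ord_max)) =>
    [] [] [] [].
- move=> M; rewrite midx2_eq !ffunE /= andbC ![M _ == _]eq_sym => /negPf MJ.
  by rewrite braiding_tbasis MJ mulr0 scale0r.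
- move=> I; rewrite midx2_eq !ffunE /= => /negPf IL.
  by rewrite braiding_tbasis IL mulr0 scale0r.
Qed.

Lemma contraction_tbasis (I : midx V 2) L :
  contraction beta (tbasis I) L = gram beta (I ord0) (I ord_max).
Proof. by rewrite textendE !ffunE mxE [LHS]mulr1. Qed.

(** This is the invariance clause of [OSp] read as an identity of matrix coefficients. *)
Lemma OSp_hom_contraction : OSp_hom beta (contraction beta).
Proof.
split=> [|A g [_ _ gP] J L].
  apply: even_hom => I L; rewrite contraction_tbasis => /(gram_par beta_osp) I01.
  by rewrite tpar0 tpar2 I01 addbb.
rewrite (sum_midx0 _ L) contraction_tbasis diag_act0 gramE -gP.
pose F i j := ((-1) ^+ ((par i (+) par (J ord0)) && par j) *
  beta (hbasis V)`_i (hbasis V)`_j) *: (g i (J ord0) * g j (J ord_max)).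
rewrite -(sum_midx2 F); apply: eq_bigr => I _.
rewrite contraction_tbasis gramE diag_act2 /F -scalerA [in RHS]scalerA mulrC
  -scalerA.
by rewrite scaler_sign -mulr_sign.
Qed.

Lemma cocontraction_tbasis I (L : midx V 2) :
  cocontraction beta (tbasis I) L = invmx (gram beta) (L ord0) (L ord_max).
Proof. by rewrite textendE c0E. Qed.

(* With C the inverse Gram matrix and g' the supertranspose, preservation of  *)
(* the form says g' B g = B, and invertibility of g turns this into g C g' = C. *)
Lemma OSp_inverse (A : comm_superalgebra K) (g : 'M[A]_n) (p q : 'I_n) :
  OSp beta g ->
  \sum_i \sum_j invmx (gram beta) i j *:
     ((-1) ^+ ((par q (+) par j) && par q) * (g p i * g q j)) =
  (invmx (gram beta) p q)%:A.
Proof.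
case=> _ [h [gh _]] gP.
pose B : 'M[A]_n := map_mx (in_alg A) (gram beta).
pose C : 'M[A]_n := map_mx (in_alg A) (invmx (gram beta)).
pose gt : 'M[A]_n := \matrix_(i, k) ((-1) ^+ ((par k (+) par i) && par k) * g k i).
have gU := gram_unit beta_nd.
have BC : B *m C = 1%:M by rewrite -map_mxM mulmxV // map_mx1.
have CB : C *m B = 1%:M by rewrite -map_mxM mulVmx // map_mx1.
have gBg : gt *m (B *m g) = B.
  apply/matrixP=> i j; rewrite !mxE /= ?gramE -gP; apply: eq_bigr => k _.
  rewrite !mxE mulr_sumr; apply: eq_bigr => l _; rewrite !mxE /= ?gramE.
  have [->|kl] := eqVneq (beta (hbasis V)`_k (hbasis V)`_l) 0.
    by rewrite mulr0 !scale0r mul0r mulr0.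
  (* The sign in [OSp] involves the parity of [l], that in [gt] the parity of [k]; they agree where
     the Gram entry is nonzero. *)
  have <- : par k = par l by apply: (gram_par beta_osp); rewrite gramE.
  rewrite mulr_algl -scalerAr [in RHS]mulrC -[RHS]scalerA; congr (_ *: _).
  by rewrite -mulrA scaler_sign -mulr_sign.
(* Multiply on the right by [B *m g *m h *m C], which is 1, and collapse [gt *m B *m g] to [B]. *)
have gCg : g *m C *m gt = C.
  transitivity (g *m C *m gt *m (B *m (g *m (h *m C)))).
    by rewrite (mulmxA g h C) gh mul1mx BC mulmx1.
  rewrite (mulmxA B g) -(mulmxA (g *m C) gt) (mulmxA gt (B *m g)) gBg.
  by rewrite (mulmxA (g *m C) B) -(mulmxA g C B) CB mulmx1 mulmxA gh mul1mx.
have /matrixP/(_ p q) := gCg; rewrite !mxE /= => <-.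
rewrite exchange_big; apply: eq_bigr => j _; rewrite !mxE mulr_suml.
apply: eq_bigr => i _; rewrite !mxE /= mulr_algr -scalerAl; congr (_ *: _).
by rewrite mulrA [in RHS]mulrA (commr_sign (g p i)).
Qed.

Lemma OSp_hom_cocontraction : OSp_hom beta (cocontraction beta).
Proof.
split=> [|A g gO J L].
  apply: even_hom => I L; rewrite cocontraction_tbasis.
  by move/(invgram_par beta_osp beta_nd) => L01; rewrite tpar0 tpar2 L01 addbb.
rewrite (sum_midx0 _ J) cocontraction_tbasis diag_act0.
pose F i j := invmx (gram beta) i j *: ((-1) ^+ ((par (L ord_max) (+) par j)
  && par (L ord_max)) * (g (L ord0) i * g (L ord_max) j)).
(* The discrepancy between the sign of [diag_act] and that of [OSp_inverse]. It is trivial unless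
   the inverse Gram entry at [L] vanishes, and then both sides are 0. *)
pose s := (par (L ord0) (+) par (L ord_max)) && par (L ord_max).
transitivity ((-1) ^+ s *: \sum_(M : midx V 2) F (M ord0) (M ord_max)); last first.
  rewrite scaler_sumr; apply: eq_bigr => M _.
  rewrite cocontraction_tbasis diag_act2 /F.
  have [->|/(invgram_par beta_osp beta_nd) M01] :=
    eqVneq (invmx (gram beta) (M ord0) (M ord_max)) 0.
    by rewrite !scale0r scaler0.
  rewrite scalerA mulrC -scalerA; congr (_ *: _); rewrite scaler_sign -mulr_sign.
  rewrite mulrA -signr_addb -M01; congr ((-1) ^+ _ * _); rewrite /s.
  by case: (par (L ord0)) (par (L ord_max)) (par (M ord0)) => [] [] [].
rewrite sum_midx2 (OSp_inverse _ _ gO) scalerA; congr (_ *: _).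
have [->|/(invgram_par beta_osp beta_nd) L01] :=
  eqVneq (invmx (gram beta) (L ord0) (L ord_max)) 0; first by rewrite mulr0.
by rewrite /s L01 addbb mul1r.
Qed.

Lemma OSp_hom0 r s : OSp_hom beta (0 : 'Hom(tpow V r, tpow V s)).
Proof.
split=> [|A g _ J L]; first by apply: even_hom => I L; rewrite lfunE ffunE eqxx.
by rewrite !big1 // => I _; rewrite lfunE ffunE scale0r.
Qed.

Lemma OSp_hom_linear r s (c : K) (f f' : 'Hom(tpow V r, tpow V s)) :
  OSp_hom beta f -> OSp_hom beta f' -> OSp_hom beta (c *: f + f').
Proof.
move=> [f0 fg] [f0' fg']; split=> [|A g gO J L].
  apply: even_hom => I L; rewrite !lfunE /= !ffunE lfunE /= ffunE => fL.
  have [f0L|fL0] := eqVneq (f (tbasis I) L) 0.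
    apply: (f0' _ _ (@tpow_deg_tbasis _ _ _ I)).
    by rewrite f0L scaler0 add0r in fL.
  exact: (f0 _ _ (@tpow_deg_tbasis _ _ _ I)).
under eq_bigr => I _ do rewrite !lfunE /= !ffunE lfunE /= ffunE scalerDl -scalerA.
under [RHS]eq_bigr => M _ do rewrite !lfunE /= !ffunE lfunE /= ffunE scalerDl
  -scalerA.
by rewrite !big_split /= -!scaler_sumr fg // fg'.
Qed.

(** Being a morphism quantifies over all commutative superalgebras and is not a boolean condition,
    whence proof irrelevance. *)
Lemma TG_hom_eq r s (f f' : TG_hom beta r s) : TG_map f = TG_map f' -> f = f'.
Proof.
case: f f' => f fP [f' fP'] /= E; subst f'.
by rewrite (proof_irrelevance _ fP fP').
Qed.

Lemma tens_homE r s r' s' (f : 'Hom(tpow V r, tpow V s))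
    (f' : 'Hom(tpow V r', tpow V s')) I L :
  tens_hom f f' (tbasis I) L =
  f (tbasis (lidx I)) (lidx L) * f' (tbasis (ridx I)) (ridx L).
Proof. by rewrite textendE ffunE. Qed.

Lemma tens_hom_id r s :
  tens_hom (\1%VF : 'Hom(tpow V r, _)) (\1%VF : 'Hom(tpow V s, _)) = \1%VF.
Proof.
apply: hom_eqP => I L; rewrite tens_homE !id_lfunE.
by rewrite [in RHS]tbasis_tens [RHS]ffunE.
Qed.

Local Notation diag_map := (diag_map beta).

(** Loop-free composition is essential: a factor [sdim V] could be zero in [K], and equivariance of
    the multiple would then say nothing about [diag_map] of the composite. *)
Lemma OSp_hom_diag_map k l (D : diagram k l) : OSp_hom beta (diag_map D).
Proof.
elim/diagram_ind: D => [||||| {}k {}l m D1 D2 loops0 P1 P2 | {}k {}l k' l' D D'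
  P P'].
- by rewrite diag_map_id0 //; apply: TG_idP.
- by rewrite diag_map_I //; apply: TG_idP.
- by rewrite diag_map_X //; apply: OSp_hom_braiding.
- by rewrite diag_map_A //; apply: OSp_hom_contraction.
- by rewrite diag_map_U //; apply: OSp_hom_cocontraction.
- have := TG_compP (TGHom P1) (TGHom P2).
  by rewrite /= diag_map_comp // loops0 scale1r.
- by rewrite diag_map_juxt //; apply: (TG_tensorP (TGHom P) (TGHom P')).
Qed.

(** * Linear extension to the Brauer category *)

Definition brauer_map k l (a : brauer K k l) : 'Hom(tpow V k, tpow V l) :=
  \sum_D a D *: diag_map D.

Lemma brauer_map_is_linear k l : linear (@brauer_map k l).
Proof.
move=> c a b; rewrite /brauer_map scaler_sumr -big_split /=.
by apply: eq_bigr => D _; rewrite !ffunE scalerDl scalerA.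
Qed.

HB.instance Definition _ k l := GRing.isLinear.Build K (brauer K k l)
  'Hom(tpow V k, tpow V l) _ (@brauer_map k l) (@brauer_map_is_linear k l).

Lemma brauer_map_bvec k l (D : diagram k l) : brauer_map (bvec K D) = diag_map D.
Proof.
rewrite /brauer_map (bigD1 D) //= ffunE eqxx scale1r big1 ?addr0 // => E /negPf ED.
by rewrite ffunE ED scale0r.
Qed.

Lemma OSp_hom_brauer_map k l (a : brauer K k l) : OSp_hom beta (brauer_map a).
Proof.
rewrite /brauer_map; elim/big_rec: _ => [|D f _ fP]; first exact: OSp_hom0.
exact: OSp_hom_linear (OSp_hom_diag_map D) fP.
Qed.

Definition brauer_functor k l (a : brauer K k l) : TG_hom beta k l :=
  TGHom (OSp_hom_brauer_map a).

Lemma diag_map_id k : diag_map (diag_id k) = \1%VF.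
Proof.
elim: k => [|k IHk]; first exact: diag_map_id0.
have := diag_map_juxt beta_osp beta_nd (diag_id 1) (diag_id k).
by rewrite juxt_id IHk diag_map_I // tens_hom_id.
Qed.

Lemma brauer_map_comp k l m (a : brauer K l m) (b : brauer K k l) :
  brauer_map (brauer_comp (sdim V)%:~R a b) = (brauer_map a \o brauer_map b)%VF.
Proof.
rewrite /brauer_comp linear_sum; apply/lfunP=> t; rewrite sum_lfunE lfunE /=.
rewrite [brauer_map a]/brauer_map sum_lfunE; apply: eq_bigr => D1 _.
rewrite linear_sum sum_lfunE scale_lfunE [brauer_map b]/brauer_map sum_lfunE
  linear_sum scaler_sumr.
apply: eq_bigr => D2 _; rewrite linearZ /= brauer_map_bvec !scale_lfunE linearZ /=.
have /lfunP/(_ t) := diag_map_comp beta_osp beta_nd D1 D2.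
by rewrite lfunE scale_lfunE /= => ->; rewrite !scalerA.
Qed.

Lemma brauer_map_tensor k l k' l' (a : brauer K k l) (a' : brauer K k' l') :
  brauer_map (brauer_tensor a a') = tens_hom (brauer_map a) (brauer_map a').
Proof.
apply: hom_eqP => I L; rewrite tens_homE /brauer_tensor linear_sum.
rewrite [brauer_map a]/brauer_map [brauer_map a']/brauer_map !sum_lfunE !sum_ffunE.
rewrite big_distrlr; apply: eq_bigr => D _ /=.
rewrite linear_sum sum_lfunE sum_ffunE; apply: eq_bigr => D' _.
rewrite linearZ /= brauer_map_bvec diag_map_juxt // !scale_lfunE !ffunE tens_homE.
exact: mulrACA.
Qed.

Lemma brauer_comp_bvec (delta : K) k l m (D1 : diagram l m) (D2 : diagram k l) :
  brauer_comp delta (bvec K D1) (bvec K D2) =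
  delta ^+ closed_loops D1 D2 *: bvec K (diag_comp D1 D2).
Proof.
rewrite /brauer_comp (bigD1 D1) //= (bigD1 D2) //= !ffunE !eqxx !mul1r.
rewrite !big1 ?addr0 // => [E /negPf ED|E /negPf ED].
  by rewrite big1 // => E' _; rewrite ffunE ED !mul0r scale0r.
by rewrite !ffunE ED mulr0 mul0r scale0r.
Qed.

Lemma brauer_tensor_bvec k l k' l' (D : diagram k l) (D' : diagram k' l') :
  brauer_tensor (bvec K D) (bvec K D') = bvec K (juxt D D').
Proof.
rewrite /brauer_tensor (bigD1 D) //= (bigD1 D') //= !ffunE !eqxx mul1r scale1r.
rewrite !big1 ?addr0 // => [E /negPf ED|E /negPf ED].
  by rewrite big1 // => E' _; rewrite ffunE ED mul0r scale0r.
by rewrite !ffunE ED mulr0 scale0r.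
Qed.

Lemma brauer_expand k l (a : brauer K k l) : a = \sum_D a D *: bvec K D.
Proof.
apply/ffunP=> D; rewrite sum_ffunE (bigD1 D) //= big1 ?addr0 => [|E /negPf ED].
  by rewrite !ffunE eqxx [RHS]mulr1.
by rewrite !ffunE eq_sym ED scaler0.
Qed.

End Equivariance.

Theorem theorem5p5 (K : fieldType) (V : superspace K) (beta : {biscalar V})
    (beta_osp : orthosymplectic beta) (beta_nd : nondegenerate_form beta) :
  exists! F : (forall k l : nat, brauer K k l -> TG_hom beta k l),
    [/\ linear_functor F,
        [/\ TG_map (F 1%N 1%N (bvec K diag_I)) = \1%VF,
            TG_map (F 2%N 2%N (bvec K diag_X)) = braiding V,
            TG_map (F 0%N 2%N (bvec K diag_U)) = cocontraction beta &
            TG_map (F 2%N 0%N (bvec K diag_A)) = contraction beta] &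
        forall (k l k' l' : nat) (a : brauer K k l) (a' : brauer K k' l'),
          F (k + k')%N (l + l')%N (brauer_tensor a a') =
          TG_tensor (F k l a) (F k' l' a')].
Proof.
exists (brauer_functor beta_osp beta_nd); split.
  split; [split | split | ] => [k l|k|k l m a b|||||k l k' l' a a'].
  - exact: brauer_map_is_linear.
  - by apply: TG_hom_eq; rewrite /= brauer_map_bvec diag_map_id.
  - by apply: TG_hom_eq; apply: brauer_map_comp.
  - by rewrite /= brauer_map_bvec diag_map_I.
  - by rewrite /= brauer_map_bvec diag_map_X.
  - by rewrite /= brauer_map_bvec diag_map_U.
  - by rewrite /= brauer_map_bvec diag_map_A.
  - by apply: TG_hom_eq; apply: brauer_map_tensor.
move=> F [[Flin Fid Fcomp] [F_I F_X F_U F_A] Ftens].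
(* Uniqueness on diagrams: the empty diagram is an identity, the generators are prescribed, and
   without loops the composite of two basis vectors is again a basis vector. *)
have F_bvec k l (D : diagram k l) : TG_map (F k l (bvec K D)) = diag_map beta D.
  elim/diagram_ind: D => [||||| {}k {}l m D1 D2 loops0 P1 P2 | {}k {}l k' l' D
    D' P P'].
  - by rewrite Fid diag_map_id0.
  - by rewrite F_I diag_map_I.
  - by rewrite F_X diag_map_X.
  - by rewrite F_A diag_map_A.
  - by rewrite F_U diag_map_U.
  - have := congr1 (@TG_map _ _ _ _ _) (Fcomp _ _ _ (bvec K D1) (bvec K D2)).
    by rewrite brauer_comp_bvec loops0 scale1r /= P1 P2 diag_map_comp // loops0
      scale1r.
  - have := congr1 (@TG_map _ _ _ _ _) (Ftens _ _ _ _ (bvec K D) (bvec K D')).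
    by rewrite brauer_tensor_bvec /= P P' -diag_map_juxt.
apply: functional_extensionality_dep =>
  k; apply: functional_extensionality_dep => l.
apply: functional_extensionality_dep => a; apply: TG_hom_eq.
(* Packing [F k l] as a linear map makes it distribute over the expansion of [a] in diagrams. *)
pose f : {linear brauer K k l -> 'Hom(tpow V k, tpow V l)} :=
  HB.pack (fun a => TG_map (F k l a)) (GRing.isLinear.Build _ _ _ _ _ (Flin k l)).
rewrite -[RHS]/(f a) [in RHS](brauer_expand a) linear_sum.
by apply: eq_bigr => D _; rewrite linearZ /= F_bvec.
Qed.
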